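(* Let $N,M\ge2$. Among NE approximators targeting games with number of players $n\le N$ and $|\mathcal A_i|\le M$, let $\mathcal F^{\mathrm{NE}}_{\mathrm{general}}$ be the class of all of them, and let $\mathcal F^{\mathrm{NE}}_{\mathrm{OPI}}$, $\mathcal F^{\mathrm{NE}}_{\mathrm{PPE}}$, $\mathcal F^{\mathrm{NE}}_{\mathrm{both}}$ be the classes of all those that are OPI, PPE, and both OPI and PPE, respectively. Then $$\mathrm{SWR}_{N,M}(\mathcal F^{\mathrm{NE}}_{\mathrm{OPI}},\mathcal F^{\mathrm{NE}}_{\mathrm{general}})=\frac1{M^{N-1}},\qquad \mathrm{SWR}_{N,M}(\mathcal F^{\mathrm{NE}}_{\mathrm{PPE}},\mathcal F^{\mathrm{NE}}_{\mathrm{general}})\le\frac1M,\qquad \mathrm{SWR}_{N,M}(\mathcal F^{\mathrm{NE}}_{\mathrm{both}},\mathcal F^{\mathrm{NE}}_{\mathrm{general}})=\frac1{M^{N-1}}.$$ Additionally, when $M\ge3$, let $\widetilde{\mathcal F}^{\mathrm{NE}}_{\mathrm{general}}$ be the class of all NE oracles and $\widetilde{\mathcal F}^{\mathrm{NE}}_{\mathrm{both}}$ the class of all NE oracles that are both PPE and OPI. Then $$\mathrm{SWR}_{N,M}(\widetilde{\mathcal F}^{\mathrm{NE}}_{\mathrm{both}},\widetilde{\mathcal F}^{\mathrm{NE}}_{\mathrm{general}})=0.$$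
   Context: A normal-form game $\Gamma_u=(n,\mathcal A,u)$ has $n\ge2$ players, finite action sets $\mathcal A_i=\{1,\dots,m_i\}$, $\mathcal A=\prod_i\mathcal A_i$, and payoff $u=(u_i)_{i\in[n]}$ with $u_i:\mathcal A\to[0,1]$. A product strategy is $\sigma=(\sigma_i)_{i\in[n]}$, $\sigma_i\in\Delta\mathcal A_i$; $u_i(\sigma)$ is expected utility. An NE approximator targeting games with $n\le N$, $|\mathcal A_i|\le M$ is a (tacitly measurable) map assigning to the payoff $u$ of each such game a product strategy $f(u)$ of that game, with components $f(u)_i$; outputs need not be equilibria. An NE oracle is an NE approximator whose output $f(u)$ is always an exact Nash equilibrium of $\Gamma_u$. Permutations: $\mathcal G_i$ is the group of all bijections $\rho_i:\mathcal A_i\to\mathcal A_i$. $\rho_iu$ is the payoff with $(\rho_iu)_j(a_i,a_{-i})=u_j(\rho_i^{-1}(a_i),a_{-i})$ for all $j$; $(\rho_i\sigma_i)(a_i)=\sigma_i(\rho_i^{-1}(a_i))$. $f$ is PPE if $f(\rho_iu)_i=\rho_if(u)_i$ for all $i$, $\rho_i\in\mathcal G_i$ and all $u$; $f$ is OPI if $f(\rho_iu)_j=f(u)_j$ for all $i$, $\rho_i\in\mathcal G_i$, $j\ne i$ and all $u$. Social welfare: $\mathrm{SW}(\sigma,u)=\sum_{i\in[n]}u_i(\sigma)$. The worst social welfare ratio of $\mathcal F_1$ over $\mathcal F_2$ is $$\mathrm{SWR}_{N,M}(\mathcal F_1,\mathcal F_2)=\inf_{\mathcal D}\frac{\sup_{f_1\in\mathcal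 F_1}\mathbb E_{u\sim\mathcal D}\,\mathrm{SW}(f_1(u),u)}{\sup_{f_2\in\mathcal F_2}\mathbb E_{u\sim\mathcal D}\,\mathrm{SW}(f_2(u),u)},$$ the infimum being over all probability distributions $\mathcal D$ on payoffs of games with $n\le N$ players and $|\mathcal A_i|\le M$ for all $i$ for which the denominator is positive. *)

(* Defs.v *)
From HB Require Import structures.
From mathcomp Require Import all_boot all_order all_algebra all_fingroup.
From mathcomp Require Import all_classical all_reals all_analysis.
Set Implicit Arguments.
Unset Strict Implicit.
Unset Printing Implicit Defensive.
Import Order.TTheory GRing.Theory Num.Theory.
Local Open Scope classical_set_scope.
Local Open Scope ring_scope.

Section Games.
Variables (R : realType) (N M : nat).

(* A number of players n with 2 <= n <= N, and for each player i a number of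
   actions m_i with 1 <= m_i <= M. Players and actions are numbered from 0. *)
Record shape := Shape {
  shape_val : {n : 'I_N.+1 & {ffun 'I_n -> 'I_M.+1}};
  _ : (2 <= tag shape_val)%N && [forall i, (1 <= tagged shape_val i)%N]
}.

HB.instance Definition _ := [isSub for shape_val].
HB.instance Definition _ := [Finite of shape by <:].

Definition players (s : shape) : finType := 'I_(tag (shape_val s)).

Definition action (s : shape) (i : players s) : finType :=
  'I_(tagged (shape_val s) i).

Definition profile (s : shape) : finType := {dffun forall i : players s, action i}.

(* The profile (x, a_{-i}). *)
Definition replace (s : shape) (a : profile s) (i : players s) (x : action i) :
  profile s := finfun (dfwith a i x).

Record payoff (s : shape) := Payoff {
  payoff_val :> {ffun players s -> {ffun profile s -> R}};
  _ : [forall i, forall a, 0 <= payoff_val i a <= 1]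
}.

HB.instance Definition _ (s : shape) := [isSub for @payoff_val s].
HB.instance Definition _ (s : shape) := [Choice of payoff s by <:].

Record simplex (A : finType) := Simplex {
  simplex_val :> {ffun A -> R};
  _ : [forall a, 0 <= simplex_val a] && (\sum_a simplex_val a == 1)
}.

HB.instance Definition _ (A : finType) := [isSub for @simplex_val A].
HB.instance Definition _ (A : finType) := [Choice of simplex A by <:].

Definition strategy (s : shape) := forall i : players s, simplex (action i).

Definition utility (s : shape) (u : payoff s) (i : players s)
    (sigma : strategy s) : R :=
  \sum_(a : profile s) (\prod_(j : players s) sigma j (a j)) * u i a.

Definition social_welfare (s : shape) (sigma : strategy s) (u : payoff s) : R :=
  \sum_(i : players s) utility u i sigma.

Definition is_nash (s : shape) (u : payoff s) (sigma : strategy s) : Prop :=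
  forall (i : players s) (tau : simplex (action i)),
    utility u i (dfwith sigma i tau) <= utility u i sigma.

Section Permutations.
Variables (s : shape) (i : players s) (rho : {perm action i}).

Lemma perm_payoff_subproof (u : payoff s) :
  [forall j, forall a, 0 <=
    ([ffun j : players s =>
       [ffun a : profile s => u j (replace a ((rho^-1)%g (a i)))]]
       : {ffun players s -> {ffun profile s -> R}}) j a <= 1].
Proof.
apply/forallP => j; apply/forallP => a; rewrite !ffunE.
by case: u => u /= /forallP/(_ j)/forallP; apply.
Qed.

Definition perm_payoff (u : payoff s) : payoff s :=
  Payoff (perm_payoff_subproof u).

Lemma perm_simplex_subproof (x : simplex (action i)) :
  let y : {ffun action i -> R} := [ffun a => x ((rho^-1)%g a)] in
  [forall a, 0 <= y a] && (\sum_a y a == 1).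
Proof.
case: x => x /= /andP[/forallP x0 /eqP x1]; apply/andP; split.
  by apply/forallP => a; rewrite ffunE.
rewrite -x1 [eqbRHS](reindex_inj (@perm_inj _ (rho^-1)%g)) /=.
by apply/eqP/eq_bigr => a _; rewrite ffunE.
Qed.

Definition perm_simplex (x : simplex (action i)) : simplex (action i) :=
  Simplex (perm_simplex_subproof x).

End Permutations.

Section PayoffMeasurable.
Variable s : shape.

Lemma payoff0_subproof :
  [forall i, forall a, 0 <=
    ([ffun=> [ffun=> 0]] : {ffun players s -> {ffun profile s -> R}}) i a <= 1].
Proof.
by apply/forallP => i; apply/forallP => a; rewrite !ffunE lexx ler01.
Qed.

HB.instance Definition _ := isPointed.Build (payoff s) (Payoff payoff0_subproof).

(* The Borel sigma-algebra of the cube, generated by the coordinates. *)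
Definition payoff_cylinders : set (set (payoff s)) :=
  [set A | exists (i : players s) (a : profile s) (B : set R),
    measurable B /\ A = [set u : payoff s | B (u i a)]].

HB.instance Definition _ :=
  Measurable.copy (payoff s) (g_sigma_algebraType payoff_cylinders).

End PayoffMeasurable.

Definition approximator := forall s : shape, payoff s -> strategy s.

Definition measurable_approximator (f : approximator) : Prop :=
  forall (s : shape) (i : players s) (a : action i),
    measurable_fun [set: payoff s] (fun u : payoff s => f s u i a).

Definition is_PPE (f : approximator) : Prop :=
  forall (s : shape) (i : players s) (rho : {perm action i}) (u : payoff s),
    f s (perm_payoff rho u) i = perm_simplex rho (f s u i).

Definition is_OPI (f : approximator) : Prop :=
  forall (s : shape) (i : players s) (rho : {perm action i}) (j : players s)
    (u : payoff s), j != i -> f s (perm_payoff rho u) j = f s u j.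

Definition NE_general : set approximator :=
  [set f | measurable_approximator f].
Definition NE_OPI : set approximator := NE_general `&` [set f | is_OPI f].
Definition NE_PPE : set approximator := NE_general `&` [set f | is_PPE f].
Definition NE_both : set approximator := NE_OPI `&` NE_PPE.

Definition oracle_general : set approximator :=
  NE_general `&` [set f | forall s (u : payoff s), is_nash u (f s u)].
Definition oracle_both : set approximator := oracle_general `&` NE_both.

Section Distributions.
(* The bounds only serve to make [game] nonempty, as measurable types must be. *)
Hypotheses (hN : (2 <= N)%N) (hM : (2 <= M)%N).

Definition game of (2 <= N)%N & (2 <= M)%N := {s : shape & payoff s}.

Lemma shape0_subproof (n := Ordinal (hN : (2 < N.+1)%N) : 'I_N.+1)
    (x := existT (fun n : 'I_N.+1 => {ffun 'I_n -> 'I_M.+1}) n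
            [ffun=> Ordinal (hM : (2 < M.+1)%N)]) :
  (2 <= tag x)%N && [forall i, (1 <= tagged x i)%N].
Proof. by apply/andP; split => //; apply/forallP => i; rewrite ffunE. Qed.

HB.instance Definition _ := Choice.on (game hN hM).
HB.instance Definition _ := isPointed.Build (game hN hM)
  (existT (fun s => payoff s) (Shape shape0_subproof) (point : payoff _)).

(* The sigma-algebra of the disjoint union over all shapes. *)
Definition game_measurable : set (set (game hN hM)) :=
  [set A | forall s, measurable [set u : payoff s | A (existT _ s u)]].

Lemma game_measurable0 : game_measurable set0.
Proof. by move=> s; exact: measurable0. Qed.

Lemma game_measurableC A : game_measurable A -> game_measurable (~` A).
Proof. by move=> mA s; exact: (measurableC (mA s)). Qed.

Lemma game_measurable_bigcup (F : (set (game hN hM))^nat) :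
  (forall k, game_measurable (F k)) -> game_measurable (\bigcup_k F k).
Proof. by move=> mF s; apply: bigcupT_measurable => k; exact: mF. Qed.

Definition game_display : measure_display. Proof. exact: default_measure_display. Qed.

HB.instance Definition _ := isMeasurable.Build game_display (game hN hM)
  game_measurable0 game_measurableC game_measurable_bigcup.

Local Open Scope ereal_scope.

Definition expected_welfare (D : probability (game hN hM) R)
    (f : approximator) : \bar R :=
  'E_D[fun g : game hN hM => social_welfare (f (tag g) (tagged g)) (tagged g)].

Definition best_welfare (F : set approximator)
    (D : probability (game hN hM) R) : \bar R :=
  ereal_sup [set expected_welfare D f | f in F].

Definition SWR (F1 F2 : set approximator) : \bar R :=
  ereal_inf [set best_welfare F1 D / best_welfare F2 D |
    D in [set D : probability (game hN hM) R | 0 < best_welfare F2 D]].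

End Distributions.
End Games.

Arguments NE_general {R N M}.
Arguments NE_OPI {R N M}.
Arguments NE_PPE {R N M}.
Arguments NE_both {R N M}.
Arguments oracle_general {R N M}.
Arguments oracle_both {R N M}.
Arguments SWR {R N M} hN hM F1 F2.

(* Main.v *)
(* A single leader who maximizes the total payoff against uniformly mixing
   opponents is equivariant under all relabellings and loses at most a factor
   M^(N-1). Conversely, let everybody be paid exactly on the diagonal of M^n
   profiles, after independent random cyclic shifts of the players' labels. An
   OPI approximator does not see the shifts at all; for n = 2 the output of a PPE
   approximator, read along the shifted diagonal, is displaced by the other
   player's shift. Either way the M profitable profiles are met with probability
   M/M^n.

   For oracles, in a two-player game with two interchangeable coordination
   actions and a safe one, an equivariant equilibrium must play the safe action,
   whose payoff is arbitrarily small. That equivariant oracles exist needs a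
   measurable choice of equilibria invariant under the stabilizer of the payoff.
   Nash's map composed with averaging over the stabilizer has such equilibria as
   fixed points; they are obtained as measurable cluster points of approximate
   fixed points on grids, which exist by Kuhn's cubical Sperner lemma. The latter
   is Stokes' theorem mod 2 for the cup product of the coboundaries of the
   labels. *)

(* PPE yields only 1/M because the condition speaks of a player's own relabelling. With two players,
   translating all labels leaves a single relative shift, which can be charged to that player. With
   more players the opponents' relative shifts remain visible to the approximator, so two-player
   games are used.

   Brouwer's theorem would give a symmetric equilibrium of each game but no measurable choice. A
   grid has finitely many candidates and every test is measurable in the payoff, so the first
   successful candidate is measurable too; the passage to the limit is then made measurable through
   a limsup. Kuhn's lemma lives on a cube with one coordinate for each action of each player, so
   grid points are first retracted to the product of simplices.

   The payoff 3/4 of the safe action lies between 1/2, which coordination earns against the uniform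
   mixture, and 1, which it earns once agreed. The ratio 0 is only an infimum over the payoff [d] of
   playing safe together. *)
From HB Require Import structures.
From mathcomp Require Import all_boot all_order all_algebra all_fingroup.
From mathcomp Require Import all_classical all_reals all_analysis.
From mathcomp Require Import measurable_realfun ring lra zify.
Require Import Defs.
Set Implicit Arguments.
Unset Strict Implicit.
Unset Printing Implicit Defensive.
Import Order.TTheory GRing.Theory Num.Theory.
Import numFieldNormedType.Exports.
Local Open Scope ring_scope.

(** * Kuhn's cubical Sperner lemma *)

Section Kuhn.
Variables (F : fieldType) (addrr0 : forall x : F, x + x = 0).

(** In characteristic 2 the two terms of each unordered pair cancel; [enum_rank] orients the
    pairs. *)
Lemma sum_sym_char2 (I : finType) (J : {set I}) (f : I -> I -> F) :
  (forall i j, f i j = f j i) -> \sum_(j in J) \sum_(i in J :\ j) f j i = 0.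
Proof.
move=> fC; pose lt (i j : I) := (enum_rank i < enum_rank j)%N.
rewrite (eq_bigr (fun j => \sum_(i in J | lt i j) f j i + \sum_(i in J | lt j i) f j i)).
  rewrite big_split /= [X in _ + X](exchange_big_dep (mem J)) /=; last by move=> i j _ /andP[].
  rewrite -big_split /=; apply: big1 => i iJ.
  rewrite [X in _ + X](eq_bigr (f i)); last by move=> j _; exact: fC.
  by rewrite iJ addrr0.
move=> j jJ; rewrite (bigID (lt^~ j)) /=; congr (_ + _); apply: eq_bigl => i.
- rewrite !inE; case: eqP => [->|_]; first by rewrite /lt ltnn !andbF.
  by [].
- rewrite !inE /lt -leqNgt leq_eqVlt; case: eqP => [->|/eqP ij]; first by rewrite ltnn !andbF.
  rewrite /= val_eqE (inj_eq enum_rank_inj) eq_sym (negbTE ij) //.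
Qed.

Variables (I : finType) (p : nat) (lab : I -> {ffun I -> 'I_p.+1} -> bool).
Local Notation X := {ffun I -> 'I_p.+1}.
Implicit Types (s : seq I) (J : {set I}) (q : X).

(** [inord] makes the step cyclic: [up] takes [p] to 0. The cup product identities therefore hold at
    every [q], and bounds enter only where genuine cubes are meant. *)
Definition up (q : X) (j : I) : X :=
  [ffun i => if i == j then inord (q i).+1 else q i].
Definition down (q : X) (j : I) : X :=
  [ffun i => if i == j then inord (q i).-1 else q i].

Lemma upC q i j : up (up q i) j = up (up q j) i.
Proof.
apply/ffunP => k; rewrite !ffunE.
by case: (k == j); case: (k == i).
Qed.

Local Notation lb k q := ((lab k q)%:R : F).

(* The cup product of the coboundaries of the labels listed in [s], evaluated
   on the cube with origin [q] and directions [J]. *)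
Fixpoint cup (s : seq I) (J : {set I}) (q : X) : F :=
  if s is k :: s' then
    \sum_(j in J) (lb k (up q j) + lb k q) * cup s' (J :\ j) (up q j)
  else 1.

(** Coboundaries are closed, and so are their cup products; the sum runs over the facets of a cube.
    Terms symmetric in the two removed directions cancel in pairs, and the others regroup into
    instances of the induction hypothesis. *)
Lemma cup_closed s J q :
  \sum_(j in J) (cup s (J :\ j) (up q j) + cup s (J :\ j) q) = 0.
Proof.
elim: s J q => [|k s IH] J q; first by apply: big1 => j _; exact: addrr0.
have setC i j : J :\ i :\ j = J :\ j :\ i by rewrite finset.setDDl finset.setUC -finset.setDDl.
pose c i j r := cup s (J :\ i :\ j) r.
rewrite [LHS](_ : _ =
  \sum_(j in J) \sum_(i in J :\ j) lb k (up (up q j) i) * c j i (up (up q j) i) +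
  \sum_(j in J) \sum_(i in J :\ j) lb k (up q j) * c j i (up (up q j) i) +
  \sum_(j in J) \sum_(i in J :\ j) lb k (up q i) * c j i (up q i) +
  \sum_(j in J) \sum_(i in J :\ j) lb k q * c j i (up q i)); last first.
  rewrite -!big_split /=; apply: eq_bigr => j _.
  rewrite -!big_split /=; apply: eq_bigr => i _.
  by rewrite !mulrDl !addrA.
rewrite sum_sym_char2 ?add0r; last by move=> i j; rewrite /c setC upC.
rewrite [X in _ + X + _](_ : _ =
    \sum_(j in J) \sum_(i in J :\ j) lb k (up q j) * c j i (up q j)); last first.
  rewrite (exchange_big_dep (mem J)) /=; last by move=> i j _; rewrite !inE => /andP[].
  apply: eq_bigr => i iJ; apply: eq_big => j; first by rewrite !inE iJ eq_sym andbT andbC.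
  by rewrite /c setC.
rewrite -big_split big1 /= ?add0r; last first.
  move=> j jJ; rewrite -big_split /=.
  transitivity (lb k (up q j) * \sum_(i in J :\ j) (c j i (up (up q j) i) + c j i (up q j))).
    by rewrite mulr_sumr; apply: eq_bigr => i _; rewrite mulrDr.
  by rewrite [X in _ * X](IH (J :\ j) (up q j)) mulr0.
rewrite [LHS](_ : _ = lb k q * \sum_(j in J) \sum_(i in J :\ j) c j i q).
  by rewrite sum_sym_char2 ?mulr0 // => i j; rewrite /c setC.
rewrite mulr_sumr; apply: eq_bigr => j jJ; rewrite -mulr_sumr; congr (_ * _).
have oppF (x : F) : - x = x by apply/eqP; rewrite eq_sym -addr_eq0 addrr0.
apply/eqP; rewrite -subr_eq0 oppF.
have := IH (J :\ j) q; rewrite big_split /= => h; exact/eqP.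
Qed.

(** Since the product over [s] is closed, multiplying it by the coboundary of label [k] gives the
    coboundary of label times product, which is a sum over facets. *)
Lemma cup_stokes k s J q : cup (k :: s) J q =
  \sum_(j in J) (lb k (up q j) * cup s (J :\ j) (up q j) + lb k q * cup s (J :\ j) q).
Proof.
have := congr1 ( *%R (lb k q)) (cup_closed s J q); rewrite mulr0 mulr_sumr => h.
rewrite /= -[LHS]addr0 -[X in _ + X = _]h -big_split /=.
apply: eq_bigr => j _; rewrite mulrDl mulrDr -addrA (addrA (lb k q * _)).
by rewrite addrr0 add0r.
Qed.

(** The cube stays in a slice where label [k] is constant, so the coboundary of this label vanishes
    on it. *)
Lemma cup_const s J q k v : k \in s -> k \notin J ->
  (forall r : X, r k = q k -> lab k r = v) -> cup s J q = 0.
Proof.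
elim: s J q => // k' s IH J q; rewrite inE => ks kJ labv /=.
apply: big1 => j jJ.
have jk : k == j = false by apply: contraNF kJ => /eqP ->.
have upk : up q j k = q k by rewrite ffunE jk.
case: (eqVneq k' k) => [->|kk'].
  by rewrite !labv // addrr0 mul0r.
rewrite IH ?mulr0 //.
- by move: ks; rewrite eq_sym (negbTE kk').
- by rewrite !inE negb_and kJ orbT.
- by move=> r; rewrite upk; exact: labv.
Qed.

Lemma cup_neq0 s J q k : (forall i, i \in J -> (q i < p)%N) -> cup s J q != 0 ->
  k \in s -> exists r r' : X,
    [/\ forall i, (q i <= r i <= (q i + (i \in J)))%N,
        forall i, (q i <= r' i <= (q i + (i \in J)))%N & lab k r != lab k r'].
Proof.
elim: s J q => // k' s IH J q qp cn0; rewrite inE => ks.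
have [j /andP[jJ]] : exists j, (j \in J) && ((lb k' (up q j) + lb k' q) * cup s (J :\ j) (up q j) != 0).
  apply/existsP; apply: contraNT cn0 => /existsPn h.
  by rewrite /= big1 // => j jJ; apply/eqP; have := h j; rewrite jJ negbK.
rewrite mulf_eq0 negb_or => /andP[ln0 cn].
have upb i : (q i <= up q j i <= q i + (i \in J))%N.
  rewrite ffunE; case: eqP => [->|_]; last by rewrite leqnn leq_addr.
  by rewrite inordK ?ltnS ?qp // jJ leqnSn addn1 leqnn.
case: (eqVneq k k') ks => [kk' _|kk' /= ks].
  rewrite -kk' in ln0.
  exists (up q j), q; split => //; first by move=> i; rewrite leqnn leq_addr.
  by apply: contraNN ln0 => /eqP ->; rewrite addrr0.
have [i|r [r' [h h' rr']]] := IH (J :\ j) (up q j) _ cn ks.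
  by rewrite !inE ffunE => /andP[/negbTE -> iJ]; exact: qp.
have bd (t : X) : (forall i, (up q j i <= t i <= up q j i + (i \in J :\ j))%N) ->
    forall i, (q i <= t i <= q i + (i \in J))%N.
  move=> ht i; have /andP[h1 h2] := ht i; have /andP[h3 h4] := upb i.
  rewrite (leq_trans h3 h1) /=; move: h2; rewrite !inE ffunE.
  case: eqP => [->|_] //=; rewrite addn0 inordK ?ltnS ?qp // jJ addn1 //.
by exists r, r'; split => //; apply: bd.
Qed.

Hypothesis p_gt0 : (0 < p)%N.
Hypothesis lab0 : forall k q, (q : X) k = ord0 -> lab k q = false.
Hypothesis labp : forall k q, (q : X) k = ord_max -> lab k q = true.

Definition box (s : seq I) (q : X) :=
  [forall i, if i \in s then (q i < p)%N else q i == ord_max].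

(** Telescoping mod 2: on each grid line in direction [j] the interior points occur twice, and the
    two ends survive. *)
Lemma box_telescope (P : pred X) (B : X -> F) j :
  (forall q r : X, (forall i, i != j -> q i = r i) -> P q = P r) ->
  \sum_(q | P q && (q j < p)%N) (B (up q j) + B q) =
  \sum_(q | P q && (q j == ord_max)) B q + \sum_(q | P q && (q j == ord0)) B q.
Proof.
move=> Pj; rewrite big_split /=.
have -> : \sum_(q | P q && (q j < p)%N) B (up q j) = \sum_(q | P q && (0 < q j)%N) B q.
  symmetry; rewrite (reindex_onto (up^~ j) (down^~ j)) /=.
    apply: eq_bigl => q.
    have -> : P (up q j) = P q by apply: Pj => i /negbTE ij; rewrite ffunE ij.
    rewrite -andbA; congr (_ && _); rewrite ffunE eqxx.
    case: (ltnP (q j) p) => qp.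
      rewrite inordK ?ltnS //=; apply/eqP/ffunP => i; rewrite !ffunE.
      by case: eqP => // ->; rewrite inordK ?ltnS //= inord_val.
    rewrite (_ : inord _ = ord0) //.
    have -> : nat_of_ord (q j) = p by apply/eqP; rewrite eqn_leq qp -ltnS ltn_ord.
    by rewrite /inord /insubd insubF // ltnn.
  move=> q /andP[_ q0]; apply/ffunP => i; rewrite !ffunE.
  case: eqP => // ->; rewrite inordK; last by rewrite (leq_ltn_trans (leq_pred _)).
  by rewrite prednK // inord_val.
have -> : \sum_(q | P q && (0 < q j)%N) B q =
    \sum_(q | P q && (0 < q j < p)%N) B q + \sum_(q | P q && (q j == ord_max)) B q.
  rewrite (bigID (fun q : X => (q j < p)%N)) /=; congr (_ + _); apply: eq_bigl => q.
    by rewrite -andbA.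
  rewrite -val_eqE /= -leqNgt -andbA; congr (_ && _).
  by have := ltn_ord (q j); rewrite ltnS; case: (ltngtP (q j) p) => //= [_|->]; rewrite ?andbF ?p_gt0.
have -> : \sum_(q | P q && (q j < p)%N) B q =
    \sum_(q | P q && (0 < q j < p)%N) B q + \sum_(q | P q && (q j == ord0)) B q.
  rewrite (bigID (fun q : X => (0 < q j)%N)) /=; congr (_ + _); apply: eq_bigl => q.
    by rewrite -andbA; congr (_ && _); rewrite andbC.
  rewrite -val_eqE /= -leqNgt leqn0 -andbA; congr (_ && _).
  by case: (eqVneq (val (q j)) 0%N) => [->|]; rewrite ?andbF ?andbT.
by rewrite addrACA addrr0 add0r.
Qed.

(** By Stokes the total over a face becomes a total over its boundary. On the two sides across a
    direction [j] other than [k], label [j] is constant and the product vanishes; on the side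
    [q k = 0] the factor [lab k] is 0. Only the side [q k = p] survives, with factor 1, and it is a
    face of the next lower dimension. *)
Lemma cup_total s : uniq s -> \sum_(q | box s q) cup s [set i in s] q = 1.
Proof.
elim: s => [_|k s IH]; last rewrite cons_uniq => /andP[ks us].
  rewrite (big_pred1 [ffun=> ord_max]) // => q; apply/forallP/eqP => [h|-> i].
    by apply/ffunP => i; rewrite ffunE; apply/eqP; have := h i.
  by rewrite ffunE.
rewrite -[RHS](IH us); set J := [set i in k :: s].
under eq_bigr do rewrite cup_stokes.
rewrite exchange_big /=.
have kJ : k \in J by rewrite !inE eqxx.
pose off j (q : X) := [forall i, (i != j) ==> if i \in k :: s then (q i < p)%N else q i == ord_max].
have boxE j q : j \in J -> box (k :: s) q = off j q && (q j < p)%N.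
  rewrite inE => jJ; apply/forallP/andP => [h|[/forallP h qj] i].
    by split; [apply/forallP => i; rewrite h implybT | have := h j; rewrite jJ].
  by have := h i; case: (eqVneq i j) => [->|] //=; rewrite jJ.
have offP j (q r : X) : (forall i, i != j -> q i = r i) -> off j q = off j r.
  move=> h; apply/eq_forallb => i; case: (eqVneq i j) => //= ij.
  by rewrite h.
rewrite (bigD1 k) //= [X in _ + X]big1 ?addr0.
  rewrite (eq_bigl _ _ (fun q => boxE k q kJ)) box_telescope; last exact: offP.
  rewrite [X in _ + X]big1 ?addr0; last first.
    by move=> q /andP[_ /eqP qk]; rewrite lab0 // mul0r.
  have -> : J :\ k = [set i in s].
    by apply/setP => i; rewrite !inE; case: eqP => // ->; rewrite (negbTE ks).
  apply: eq_big => [q|q /andP[_ /eqP qk]]; last by rewrite labp // mul1r.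
  apply/andP/forallP => [[/forallP h qk] i|h].
    have := h i; rewrite inE; case: (eqVneq i k) => [->|] //=.
    by rewrite (negbTE ks).
  split; last by have := h k; rewrite (negbTE ks).
  apply/forallP => i; apply/implyP => ik; have := h i.
  by rewrite inE (negbTE ik).
move=> j /andP[jJ jk]; have js : j \in s by move: jJ; rewrite !inE (negbTE jk).
rewrite (eq_bigl _ _ (fun q => boxE j q jJ)) box_telescope; last exact: offP.
have jJj : j \notin J :\ j by rewrite !inE eqxx.
rewrite !big1 ?addr0 // => q /andP[_ /eqP qj].
  by rewrite (cup_const (k := j) (v := false)) ?mulr0 // => r; rewrite qj; exact: lab0.
by rewrite (cup_const (k := j) (v := true)) ?mulr0 // => r; rewrite qj; exact: labp.
Qed.

Lemma kuhn_char2 : exists q : X, forall k, exists r r' : X,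
  [/\ forall i, (q i <= r i <= (q i).+1)%N,
      forall i, (q i <= r' i <= (q i).+1)%N, ~~ lab k r & lab k r'].
Proof.
have [q] : exists q : X, box (enum I) q && (cup (enum I) [set i in enum I] q != 0).
  apply/existsP; apply: contraT => /existsPn h.
  have := cup_total (enum_uniq I); rewrite big1 => [/eqP|q bq].
    by rewrite eq_sym oner_eq0.
  by apply/eqP; have := h q; rewrite bq negbK.
move=> /andP[/forallP bq cq]; exists q => k.
have [i|r [r' [h h' rr']]] := cup_neq0 _ cq (mem_enum I k).
  by rewrite inE => iI; have := bq i; rewrite iI.
have bd (t : X) : (forall i, (q i <= t i <= q i + (i \in [set i in enum I]))%N) ->
    forall i, (q i <= t i <= (q i).+1)%N.
  by move=> ht i; have := ht i; rewrite inE mem_enum addn1.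
move/bd: h => h; move/bd: h' => h'.
by case lr: (lab k r) rr'; case lr': (lab k r') => // _; [exists r', r | exists r, r']; rewrite lr lr'.
Qed.

End Kuhn.

Lemma kuhn (I : finType) (p : nat) (lab : I -> {ffun I -> 'I_p.+1} -> bool) :
  (0 < p)%N -> (forall k (q : {ffun I -> 'I_p.+1}), q k = ord0 -> lab k q = false) ->
  (forall k (q : {ffun I -> 'I_p.+1}), q k = ord_max -> lab k q = true) ->
  exists q : {ffun I -> 'I_p.+1}, forall k, exists r r' : {ffun I -> 'I_p.+1},
  [/\ forall i, (q i <= r i <= (q i).+1)%N,
      forall i, (q i <= r' i <= (q i).+1)%N, ~~ lab k r & lab k r'].
Proof.
by apply: (@kuhn_char2 'F_2) => x; apply: addrr_pchar2; rewrite pchar_Fp.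
Qed.

Local Open Scope classical_set_scope.

(** * Measurable selections and cluster points *)

Section MeasurableDiscrete.
Context d (T : measurableType d).

(** Measurability into a type without sigma-algebra: for the countable codomains in use, the fibres
    say everything. *)
Definition measurable_discrete (C : Type) (h : T -> C) :=
  forall c, measurable [set x | h x = c].

Lemma measurable_discrete_comp (C : countType) (h : T -> C) C' (g : C -> C') :
  measurable_discrete h -> measurable_discrete (g \o h).
Proof.
move=> mh c'.
rewrite (_ : [set _ | _] = \bigcup_c (if g c == c' :> {classic C'} then [set x | h x = c] else set0)).
  apply: countable_bigcupT_measurable; first exact: countableP.
  by move=> c; case: ifP => _; [exact: mh | exact: measurable0].
apply/seteqP; split => x /=.
  by move=> <-; exists (h x) => //; rewrite eqxx.
by move=> [c _]; case: eqP => // <- /= ->.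
Qed.

Lemma measurable_discrete_ffun (F : finType) (C : eqType) (h : F -> T -> C) :
  (forall t, measurable_discrete (h t)) ->
  measurable_discrete (fun x => [ffun t => h t x]).
Proof.
move=> mh f.
rewrite (_ : [set _ | _] = \bigcap_(t in [set: F]) [set x | h t x = f t]).
  by apply: fin_bigcap_measurable => // t _; exact: mh.
apply/seteqP; split => x /=; first by move=> <- t _; rewrite /= ffunE.
by move=> h'; apply/ffunP => t; rewrite ffunE; exact: h'.
Qed.

Lemma measurable_discrete_bool (b : T -> bool) :
  measurable [set x | b x] -> measurable_discrete b.
Proof.
move=> mb [] //; rewrite (_ : [set _ | _] = ~` [set x | b x]); first exact: measurableC.
by apply/seteqP; split => x /=; case: (b x).
Qed.

(** A measurable discrete index may be frozen: the domain splits into countably many measurable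
    fibres. *)
Lemma measurable_fun_discrete d' (T' : measurableType d') (C : countType) (h : T -> C)
    (G : C -> T -> T') : measurable_discrete h ->
  (forall c, measurable_fun [set: T] (G c)) ->
  measurable_fun [set: T] (fun x => G (h x) x).
Proof.
move=> mh mG _ B mB; rewrite setTI.
rewrite (_ : _ @^-1` _ = \bigcup_c ([set x | h x = c] `&` (G c @^-1` B))).
  apply: countable_bigcupT_measurable; first exact: countableP.
  move=> c; apply: measurableI; first exact: mh.
  by rewrite -[X in measurable X]setTI; exact: mG.
apply/seteqP; split => x /=; first by move=> ?; exists (h x).
by move=> [c _ [/= ->]].
Qed.

(* Taking [pick] for [g] gives measurable choices of an index satisfying [P]. *)
Lemma measurable_discrete_select (F : finType) (P : F -> T -> bool) C (g : {ffun F -> bool} -> C) :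
  (forall t, measurable [set x | P t x]) ->
  measurable_discrete (fun x => g [ffun t => P t x]).
Proof.
move=> mP; apply: (measurable_discrete_comp g).
by apply: measurable_discrete_ffun => t; exact: measurable_discrete_bool.
Qed.

Lemma measurable_discrete_first (n : T -> nat -> bool) (f : T -> nat) :
  (forall k, measurable [set x | n x k]) ->
  (forall x k, f x = k <-> (n x k /\ forall j, (j < k)%N -> ~~ n x j)) ->
  measurable_discrete f.
Proof.
move=> mn fE k.
rewrite (_ : [set _ | _] = [set x | n x k] `&` \bigcap_(j in [set j | (j < k)%N]) ~` [set x | n x j]).
  apply: measurableI => //; apply: bigcap_measurableType => j _; exact: measurableC.
apply/seteqP; split => x /=.
  by move=> /fE[h1 h2]; split => // j /= /h2 /negP.
by move=> [h1 h2]; apply/fE; split => // j /h2 /negP.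
Qed.

End MeasurableDiscrete.

Section Cluster.
Context d (T : measurableType d) (R : realType).

(** The tail suprema converge to the limsup, and each of them is approached within its tail. *)
Lemma limn_sup_often (u : R^nat) (e : R) k : has_ubound (range u) -> has_lbound (range u) ->
  0 < e -> exists2 n, (k <= n)%N & `|u n - limn_sup u| < e.
Proof.
move=> ub lb e0.
have cs : sups u @ \oo --> limn_sup u.
  by rewrite /limn_sup; apply/cvg_ex; eexists; exact: cvg_sups_inf.
have [m /= km hm] : exists2 m, (k <= m)%N & `|limn_sup u - sups u m| < e / 2.
  have /cvgrPdist_lt /(_ (e / 2)) : sups u @ \oo --> limn_sup u by exact: cs.
  case; first by rewrite divr_gt0.
  move=> N _ hN; exists (maxn k N); first exact: leq_maxl.
  by apply: hN; exact: leq_maxr.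
have hs : has_sup (sdrop u m).
  by split; [exists (u m), m => /=|exact: has_ubound_sdrop].
have [_ [n /= mn <-] hn] := sup_adherent (divr_gt0 e0 (ltr0Sn R 1)) hs.
exists n; first exact: leq_trans mn.
have un : u n <= sups u m by apply: ub_le_sup; [exact: has_ubound_sdrop|exists n].
rewrite (_ : u n - _ = (u n - sups u m) - (limn_sup u - sups u m)); last by rewrite opprB addrA subrK.
rewrite (le_lt_trans (ler_normB _ _)) // [e]splitr ltrD //.
by rewrite ler0_norm ?subr_le0 // opprB ltrBlDr addrC -ltrBlDr.
Qed.

Lemma measurable_cluster1 (z : nat -> T -> R) :
  (forall n, measurable_fun setT (z n)) -> (forall n x, 0 <= z n x <= 1) ->
  exists m : nat -> T -> nat, [/\ forall k, measurable_discrete (m k),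
    forall k x, (k <= m k x)%N & forall x, cvgn (fun k => z (m k x) x)].
Proof.
move=> mz z01.
have ub x : has_ubound (range (z^~ x)) by exists 1 => _ [n _ <-]; case/andP: (z01 n x).
have lb x : has_lbound (range (z^~ x)) by exists 0 => _ [n _ <-]; case/andP: (z01 n x).
pose L x := limn_sup (z^~ x).
have mL : measurable_fun setT L.
  by by apply: measurable_fun_limn_sup => [x _|x _|//]; [exact: ub|exact: lb].
(* The index taken is the first one from [k] on whose term is within [1/(k+1)] of the limsup. The
   bound [k <= m k x] then lets limits pass to the chosen indices. *)
pose P k x n := (k <= n)%N && (`|z n x - L x| < k.+1%:R^-1).
have exP k x : exists n, P k x n.
  have e0 : 0 < (k.+1%:R : R)^-1 by rewrite invr_gt0 ltr0n.
  have [n kn hn] := limn_sup_often k (ub x) (lb x) e0.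
  by exists n; rewrite /P kn.
pose m k x := ex_minn (exP k x).
have mP k x : P k x (m k x) by rewrite /m; case: ex_minnP.
exists m; split.
- move=> k; apply: (measurable_discrete_first (n := P k)) => [n|x n].
    rewrite /P; case: (k <= n)%N => /=; last by rewrite (_ : [set _ | _] = set0) //; apply/seteqP; split.
    rewrite (_ : [set _ | _] = (fun x => `|z n x - L x|) @^-1` [set r | r < k.+1%:R^-1]) //.
    rewrite -[X in measurable X]setTI.
    have : measurable_fun setT (fun x => `|z n x - L x|).
      by apply: measurableT_comp => //; exact: measurable_funB.
    by apply => //; rewrite -set_itvNyo; exact: measurable_itv.
  rewrite /m; case: ex_minnP => j Pj jmin; split.
    move=> <-; split => // i; apply: contraTN => /jmin; by rewrite -leqNgt.
  move=> [Pn nmin]; apply/eqP; rewrite eqn_leq jmin //= leqNgt.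
  by apply/negP => /nmin; rewrite Pj.
- by move=> k x; case/andP: (mP k x).
- move=> x; apply/cvg_ex; exists (L x); apply/cvgrPdist_lt => e e0.
  have := near_infty_natSinv_lt (PosNum e0); apply: filterS => k /= hk.
  by rewrite distrC (lt_trans _ hk) //; case/andP: (mP k x).
Qed.

Lemma cvgn_subseq (u : R^nat) (l : R) (m : nat -> nat) :
  (forall k, (k <= m k)%N) -> u @ \oo --> l -> (fun k => u (m k)) @ \oo --> l.
Proof.
move=> km ul; apply: (cvg_comp _ _ _ ul) => A [N _ hN].
by exists N => // k /= Nk; apply: hN => /=; exact: leq_trans (km k).
Qed.

(* Bolzano-Weierstrass with measurable subsequences: the limsup is a cluster
   point depending measurably on the parameter, and coordinates are treated one
   after the other. *)
Lemma measurable_cluster (I : finType) (z : nat -> T -> I -> R) :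
  (forall n i, measurable_fun setT (fun x => z n x i)) ->
  (forall n x i, 0 <= z n x i <= 1) ->
  exists (y : T -> I -> R) (m : T -> nat -> nat),
    [/\ forall i, measurable_fun setT (fun x => y x i),
        forall x k, (k <= m x k)%N &
        forall x i, (fun k => z (m x k) x i) @ \oo --> y x i].
Proof.
move=> mz z01.
suff [m [mm km cm]] : exists m : nat -> T -> nat, [/\ forall k, measurable_discrete (m k),
    forall k x, (k <= m k x)%N & forall x i, i \in enum I -> cvgn (fun k => z (m k x) x i)].
  exists (fun x i => limn (fun k => z (m k x) x i)), (fun x k => m k x); split => //.
    move=> i; apply: (measurable_fun_cvg (h := fun k x => z (m k x) x i)).
      by move=> k; apply: (measurable_fun_discrete (h := m k) (G := fun n x => z n x i)).
    by move=> x _; apply: cm; rewrite mem_enum.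
  by move=> x i; apply: cm; rewrite mem_enum.
elim: (enum I) => [|i s [m [mm km cm]]].
  exists (fun k _ => k); split => // k c.
  have [->|/eqP kc] := eqVneq k c; first by rewrite (_ : [set _ | _] = setT) //; apply/seteqP; split.
  by rewrite (_ : [set _ | _] = set0) //; apply/seteqP; split.
have mzi k : measurable_fun setT (fun x => z (m k x) x i).
  by apply: (measurable_fun_discrete (h := m k) (G := fun n x => z n x i)).
have [m' [mm' km' cm']] := measurable_cluster1 mzi (fun k x => z01 _ x i).
exists (fun k x => m (m' k x) x); split.
- move=> k c.
  rewrite (_ : [set _ | _] = \bigcup_j ([set x | m' k x = j] `&` [set x | m j x = c])).
    by apply: bigcupT_measurable => j; apply: measurableI; [exact: mm'|exact: mm].
  apply/seteqP; split => x /=; first by move=> ?; exists (m' k x).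
  by move=> [j _ [/= ->]].
- by move=> k x; exact: leq_trans (km' k x) (km _ x).
- move=> x j; rewrite inE => /predU1P[->|js]; first exact: cm'.
  have /cvg_ex[l hl] := cm x j js; apply/cvg_ex; exists l.
  exact: (cvgn_subseq (m := m'^~ x) (fun k => km' k x) hl).
Qed.

End Cluster.

(** * Symmetric fixed points of Nash's map *)

Lemma prod_sum_dffun (R : comNzRingType) (I : finType) (T : I -> finType)
    (F : forall i, T i -> R) :
  \prod_i \sum_(x : T i) F i x =
  \sum_(a : {dffun forall i : I, T i}) \prod_i F i (a i).
Proof.
rewrite (reindex (@dffun_of_fprod I T)); last exact/onW_bij/dffun_of_fprod_bij.
pose G i := [ffun x : T i => F i x].
transitivity (\sum_(t : fprod T) \prod_(i in I) G i (t i)); last first.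
  by apply: eq_bigr => t _; apply: eq_bigr => i _; rewrite /dffun_of_fprod !ffunE.
rewrite big_fprod.
(* Dependent choices become functions into the tagged union of the [T i] that stay in their own
   fibre, where the usual distributivity law applies. *)
transitivity (\sum_(g in family (tagged_with (fun i => T i))) \prod_i untag 0 (G i) (g i)).
  rewrite -(bigA_distr_big_dep (fun i => tagged_with T i) (fun i => untag 0 (G i))).
  apply: eq_bigr => i _; rewrite -[RHS](big_tag (fun i x => G i x)).
  by apply: eq_bigr => x _; rewrite ffunE.
by apply: eq_bigr => g _; apply: eq_bigl.
Qed.

Section Vectors.
Variables (R : realType) (N M : nat) (s : shape N M).
Local Notation vec := (forall i : players s, action i -> R).
Implicit Types (u : payoff R s) (w : profile s -> R) (x z : vec) (i j : players s)
  (sigma : strategy R s).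

Lemma action_gt0 i : (0 < #|action i|)%N.
Proof. by rewrite card_ord; case: s i => v /= /andP[_ /forallP]; apply. Qed.

(** The multilinear extension of [w], on bare families of numbers rather than strategies, so that
    limits and averages are easy to form. *)
Definition value w x : R := \sum_(a : profile s) (\prod_j x j (a j)) * w a.

Definition dev_value w i (b : action i) x : R :=
  \sum_(a : profile s | a i == b) (\prod_(j | j != i) x j (a j)) * w a.

Lemma valueE w i x : value w x = \sum_b x i b * dev_value w b x.
Proof.
rewrite /value (partition_big (fun a : profile s => a i) predT) //=.
apply: eq_bigr => b _; rewrite mulr_sumr; apply: eq_bigr => a /eqP <-.
by rewrite (bigD1 i) //= mulrA.
Qed.

Lemma dev_value_ext w i (b : action i) x z :
  (forall j, j != i -> x j =1 z j) -> dev_value w b x = dev_value w b z.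
Proof.
move=> xz; apply: eq_bigr => a _; congr (_ * _).
by apply: eq_bigr => j ji; exact: xz.
Qed.

Definition is_simplex x := (forall i a, 0 <= x i a) /\ forall i, \sum_a x i a = 1.

Lemma strategy_simplex (sigma : strategy R s) : is_simplex (fun i => sigma i).
Proof.
split=> i; case: (sigma i) => f /= /andP[/forallP f0 /eqP //].
Qed.

Lemma simplex_subproof x i : is_simplex x ->
  [forall a, 0 <= [ffun a => x i a] a] && (\sum_a [ffun a => x i a] a == 1).
Proof.
move=> [x0 x1]; apply/andP; split; first by apply/forallP => a; rewrite ffunE.
by rewrite -(x1 i); apply/eqP/eq_bigr => a _; rewrite ffunE.
Qed.

Definition to_strategy x (hx : is_simplex x) : strategy R s :=
  fun i => Simplex (simplex_subproof i hx).

Lemma to_strategyE x (hx : is_simplex x) i a : to_strategy hx i a = x i a.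
Proof. by rewrite /= ffunE. Qed.

Lemma utilityE u i sigma : utility u i sigma = value (u i) (fun j => sigma j).
Proof. by []. Qed.

Lemma social_welfareE u sigma :
  social_welfare sigma u = value (fun a => \sum_i u i a) (fun j => sigma j).
Proof.
rewrite /social_welfare exchange_big; apply: eq_bigr => a _.
by rewrite mulr_sumr.
Qed.

Lemma sum_profile x : is_simplex x -> \sum_(a : profile s) \prod_j x j (a j) = 1.
Proof.
by move=> [_ x1]; rewrite -prod_sum_dffun big1.
Qed.

Lemma value_ge0 w x : is_simplex x -> (forall a, 0 <= w a) -> 0 <= value w x.
Proof.
move=> [x0 _] w0; apply: sumr_ge0 => a _; apply: mulr_ge0 => //.
by apply: prodr_ge0 => j _.
Qed.

Lemma value_le w x c : is_simplex x -> (forall a, w a <= c) -> value w x <= c.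
Proof.
move=> hx wc; rewrite -[leRHS]mul1r -(sum_profile hx) mulr_suml.
apply: ler_sum => a _; apply: ler_wpM2l => //.
by apply: prodr_ge0 => j _; apply: hx.1.
Qed.

Lemma nashP u sigma :
  (forall i (b : action i), dev_value (u i) b (fun j => sigma j) <= utility u i sigma) ->
  is_nash u sigma.
Proof.
move=> h i tau; rewrite [leLHS]utilityE (valueE _ i).
have [tau0 tau1] : (forall a, 0 <= tau a) /\ \sum_a tau a = 1.
  by case: (tau) => f /= /andP[/forallP f0 /eqP].
rewrite dfwithin -[leRHS]mul1r -tau1 mulr_suml.
apply: ler_sum => b _; apply: ler_wpM2l => //.
rewrite (@dev_value_ext _ _ _ _ (fun j => sigma j)) // => j ji a.
by rewrite dfwithout // eq_sym.
Qed.

Lemma delta_subproof i (b : action i) :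
  [forall a, 0 <= [ffun a => (a == b)%:R : R] a] && (\sum_a [ffun a => (a == b)%:R : R] a == 1).
Proof.
apply/andP; split; first by apply/forallP => a; rewrite ffunE ler0n.
rewrite (bigD1 b) //= ffunE eqxx big1 ?addr0 // => a /negbTE ab.
by rewrite ffunE ab.
Qed.

Definition delta i (b : action i) : simplex R (action i) := Simplex (delta_subproof b).

Lemma nash_dev u sigma i (b : action i) : is_nash u sigma ->
  dev_value (u i) b (fun j => sigma j) <= utility u i sigma.
Proof.
move=> h; have := h i (delta b); rewrite [leLHS]utilityE (valueE _ i) dfwithin.
rewrite (bigD1 b) //= ffunE eqxx mul1r big1 ?addr0 => [|a /negbTE ab]; last by rewrite ffunE ab mul0r.
rewrite (@dev_value_ext _ _ _ _ (fun j => sigma j)) // => j ji a.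
by rewrite dfwithout // eq_sym.
Qed.

(* The product group of relabellings acts on the right by pulling back:
   [(u g)(a) = u(g a)], so no inverses are needed. *)
Definition relabeling : finType := {dffun forall i : players s, {perm action i}}.
Implicit Types (g h : relabeling).

Definition relabel g (a : profile s) : profile s := finfun (fun i => g i (a i)).
Definition relabeling_comp g h : relabeling := finfun (fun i => (h i * g i)%g).
Definition relabeling_inv g : relabeling := finfun (fun i => (g i)^-1%g).
Definition relabeling1 : relabeling := finfun (fun i => 1%g).

Lemma relabel_payoff_subproof g u :
  [forall j, forall a, 0 <=
    ([ffun j : players s => [ffun a : profile s => u j (relabel g a)]]
       : {ffun players s -> {ffun profile s -> R}}) j a <= 1].
Proof.
apply/forallP => j; apply/forallP => a; rewrite !ffunE.
by case: u => u /= /forallP/(_ j)/forallP; apply.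
Qed.

Definition relabel_payoff u g : payoff R s := Payoff (relabel_payoff_subproof g u).

Definition relabel_vec x g : vec := fun i a => x i (g i a).

Lemma relabel_payoffE u g i a : relabel_payoff u g i a = u i (relabel g a).
Proof. by rewrite /= !ffunE. Qed.

Lemma payoffP u (v : payoff R s) : (forall i a, u i a = v i a) -> u = v.
Proof. by move=> uv; apply/val_inj/ffunP => i; apply/ffunP => a; exact: uv. Qed.

Lemma relabel_payoff_comp u g h :
  relabel_payoff (relabel_payoff u g) h = relabel_payoff u (relabeling_comp g h).
Proof.
apply: payoffP => i a; rewrite !relabel_payoffE; congr (u i _).
by apply/ffunP => j; rewrite !ffunE permM.
Qed.

Lemma relabel_payoff1 u : relabel_payoff u relabeling1 = u.
Proof.
apply: payoffP => i a; rewrite relabel_payoffE; congr (u i _).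
by apply/ffunP => j; rewrite !ffunE perm1.
Qed.

Lemma relabeling_compV g : relabeling_comp g (relabeling_inv g) = relabeling1.
Proof. by apply/ffunP => i; rewrite !ffunE mulVg. Qed.
Lemma relabeling_compVr g : relabeling_comp (relabeling_inv g) g = relabeling1.
Proof. by apply/ffunP => i; rewrite !ffunE mulgV. Qed.
Lemma relabeling_compA g h k :
  relabeling_comp g (relabeling_comp h k) = relabeling_comp (relabeling_comp g h) k.
Proof. by apply/ffunP => i; rewrite !ffunE mulgA. Qed.
Lemma relabeling_comp1 g : relabeling_comp g relabeling1 = g.
Proof. by apply/ffunP => i; rewrite !ffunE mul1g. Qed.
Lemma relabeling_1comp g : relabeling_comp relabeling1 g = g.
Proof. by apply/ffunP => i; rewrite !ffunE mulg1. Qed.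

Lemma relabel_bij g : bijective (relabel g).
Proof.
exists (relabel (relabeling_inv g)) => a; apply/ffunP => i; rewrite !ffunE.
  by rewrite permK.
by rewrite permKV.
Qed.

Lemma value_relabel u g i x :
  value (relabel_payoff u g i) (relabel_vec x g) = value (u i) x.
Proof.
rewrite [RHS](reindex (relabel g)); last exact/onW_bij/relabel_bij.
apply: eq_bigr => a _; rewrite relabel_payoffE; congr (_ * _).
by apply: eq_bigr => j _; rewrite ffunE.
Qed.

Lemma dev_value_relabel u g i (b : action i) x :
  dev_value (relabel_payoff u g i) b (relabel_vec x g) = dev_value (u i) (g i b) x.
Proof.
rewrite [RHS](reindex (relabel g)); last exact/onW_bij/relabel_bij.
apply: eq_big => a; first by rewrite ffunE (inj_eq perm_inj).
move=> _; rewrite relabel_payoffE; congr (_ * _).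
by apply: eq_bigr => j _; rewrite ffunE.
Qed.

Definition stabilizer u : {set relabeling} := [set g | relabel_payoff u g == u].

Lemma stabilizer1 u : relabeling1 \in stabilizer u.
Proof. by rewrite inE relabel_payoff1. Qed.

Definition average (A : {set relabeling}) x : vec :=
  fun i a => (#|A|%:R)^-1 * \sum_(g in A) x i (g i a).

Lemma average_simplex (A : {set relabeling}) x :
  A != finset.set0 -> is_simplex x -> is_simplex (average A x).
Proof.
rewrite -card_gt0 => A0 [x0 x1]; split=> i.
  by move=> a; rewrite mulr_ge0 ?invr_ge0 ?ler0n // sumr_ge0.
rewrite -mulr_sumr exchange_big /= (eq_bigr (fun=> 1)); last first.
  move=> g _; rewrite -(x1 i) [RHS](reindex_inj (@perm_inj _ (g i))) //.
by rewrite sumr_const mulVf // pnatr_eq0 -lt0n.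
Qed.

(** Composition with [h] permutes the stabilizer. *)
Lemma average_stable u h x : h \in stabilizer u ->
  forall i (a : action i), average (stabilizer u) x (h i a) = average (stabilizer u) x a.
Proof.
move=> hu i a; congr (_ * _).
rewrite [RHS](reindex_onto (fun g => relabeling_comp g h) (fun g => relabeling_comp g (relabeling_inv h))) /=; last first.
  by move=> g _; rewrite -relabeling_compA relabeling_compVr relabeling_comp1.
apply: eq_big => g; last by move=> _; rewrite ffunE permM.
rewrite -relabeling_compA relabeling_compV relabeling_comp1 eqxx andbT !inE -relabel_payoff_comp.
have hv : relabel_payoff u h = u by apply/eqP; move: hu; rewrite inE.
apply/eqP/eqP => [->//|e].
have := congr1 (relabel_payoff^~ (relabeling_inv h)) e.
rewrite -[X in _ = relabel_payoff X _]hv !relabel_payoff_comp.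
by rewrite !relabeling_compV relabel_payoff1 relabeling_comp1.
Qed.

Lemma average_id u x : (forall g, g \in stabilizer u -> forall i a, x i (g i a) = x i a) ->
  forall i (a : action i), average (stabilizer u) x a = x i a.
Proof.
move=> hx i a; rewrite /average (eq_bigr (fun=> x i a)) => [|g gu]; last exact: hx.
rewrite sumr_const -[x i a *+ _]mulr_natl mulrA mulVf ?mul1r // pnatr_eq0 -lt0n card_gt0.
by apply/finset.set0Pn; exists relabeling1; exact: stabilizer1.
Qed.

(** A continuous retraction of the nonnegative vectors onto the product of simplices: excess mass is
    scaled away, missing mass is spread uniformly. *)
Definition retract x : vec := fun i a =>
  x i a / Num.max 1 (\sum_b x i b) + Num.max 0 (1 - \sum_b x i b) / #|action i|%:R.

Lemma retract_simplex x : (forall i a, 0 <= x i a) -> is_simplex (retract x).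
Proof.
move=> x0; split=> i.
  move=> a; apply: addr_ge0; apply: divr_ge0 => //; rewrite ?ler0n ?le_max ?lexx ?ler01 //.
rewrite big_split /= -mulr_suml sumr_const -[X in _ + X]mulr_natr mulfVK; last first.
  by rewrite pnatr_eq0 -lt0n action_gt0.
set S := \sum_b _; case: (leP 1 S) => S1.
  rewrite divff ?gt_eqF ?(lt_le_trans ltr01) // max_l ?addr0 //; lra.
by rewrite divr1 max_r; lra.
Qed.

Lemma retract_id x : is_simplex x -> forall i (a : action i), retract x a = x i a.
Proof.
move=> [x0 x1] i a; rewrite /retract x1 subrr maxxx !maxxx.
by rewrite mul0r addr0 divr1.
Qed.

Definition gain u i (a : action i) z : R :=
  Num.max 0 (dev_value (u i) a z - value (u i) z).

Lemma gain_ge0 u i (a : action i) z : 0 <= gain u a z.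
Proof. by rewrite le_max lexx. Qed.

(* Nash's map sends [z] to [nash_num u a z / nash_den u i z]. *)
Definition nash_num u i (a : action i) z := z i a + gain u a z.
Definition nash_den u i z := 1 + \sum_(a : action i) gain u a z.

Lemma nash_den_gt0 u i z : 0 < nash_den u i z.
Proof. by rewrite ltr_pwDl // sumr_ge0 // => a _; exact: gain_ge0. Qed.

(** This serves as a boundary condition for Kuhn's lemma: where a coordinate is 1, Nash's map cannot
    exceed it. *)
Lemma nash_num_le u i (a : action i) z : is_simplex z -> nash_num u a z <= nash_den u i z.
Proof.
move=> [z0 z1]; apply: lerD.
  by rewrite -(z1 i) (bigD1 a) //= lerDl sumr_ge0.
by rewrite (bigD1 a) //= lerDl sumr_ge0 // => b _; exact: gain_ge0.
Qed.

(** At a fixed point the gain of [a] is [z i a * S], so [z i a] times the signed advantage of [a]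
    over the value is [S * z i a ^+ 2]. Summed over [a] the former gives 0, the value being the mean
    of the deviation values. As the [z i a] sum to 1, [S] must vanish. *)
Lemma nash_fixed_point u z : is_simplex z ->
  (forall i (a : action i), nash_num u a z = z i a * nash_den u i z) ->
  forall i (b : action i), dev_value (u i) b z <= value (u i) z.
Proof.
move=> [z0 z1] fz i b; set S := \sum_(a : action i) gain u a z.
have gE (a : action i) : gain u a z = z i a * S.
  by have := fz i a; rewrite /nash_num /nash_den mulrDr mulr1 => /addrI.
have [S0|S0] := eqVneq S 0.
  have := gE b; rewrite S0 mulr0 /gain => /eqP.
  by rewrite eq_le ge_max lexx /= => /andP[]; rewrite subr_le0.
have dE (a : action i) : z i a * (dev_value (u i) a z - value (u i) z) = S * z i a ^+ 2.
  rewrite expr2 mulrCA mulrC; have := gE a; rewrite /gain.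
  have [_ ->|_ /esym/eqP] := leP 0 (dev_value (u i) a z - value (u i) z); first by ring.
  by rewrite mulf_eq0 (negbTE S0) orbF => /eqP ->; rewrite !(mul0r, mulr0).
have : \sum_a z i a * (dev_value (u i) a z - value (u i) z) = 0.
  under eq_bigr do rewrite mulrBr.
  by rewrite sumrB -valueE -mulr_suml z1 mul1r subrr.
rewrite (eq_bigr _ (fun a _ => dE a)) -mulr_sumr => /eqP.
rewrite mulf_eq0 (negbTE S0) psumr_eq0 /= => [/allP h|a _]; last exact: sqr_ge0.
have : \sum_a z i a = 0.
  by apply: big1 => a _; apply/eqP; have := h a (mem_index_enum _); rewrite sqrf_eq0.
by rewrite z1 => /eqP; rewrite oner_eq0.
Qed.

Lemma value_ext w x z : (forall i, x i =1 z i) -> value w x = value w z.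
Proof. by move=> xz; apply: eq_bigr => a _; congr (_ * _); apply: eq_bigr => j _; exact: xz. Qed.

Lemma gain_stable u g z : g \in stabilizer u -> (forall i a, z i (g i a) = z i a) ->
  forall i (a : action i), gain u (g i a) z = gain u a z.
Proof.
rewrite inE => /eqP gu gz i a; rewrite /gain -dev_value_relabel -(value_relabel u g) gu.
have e j : (fun b : action j => relabel_vec z g b) =1 z j by move=> b; exact: gz.
by rewrite (value_ext _ e) (@dev_value_ext _ _ _ _ z).
Qed.

(** A fixed point of retraction, averaging and Nash's map in succession lies in the simplices, as a
    value of Nash's map, and inherits the symmetry of [z], as Nash's map is equivariant. Retraction
    and averaging then leave it alone, so [z] agrees with [x], and [x] is fixed by Nash's map
    itself. *)
Lemma nash_symmetric_fixed_point u x : (forall i a, 0 <= x i a) ->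
  let z := average (stabilizer u) (retract x) in
  (forall i (a : action i), nash_num u a z = x i a * nash_den u i z) ->
  [/\ is_simplex x,
      forall g, g \in stabilizer u -> forall i a, x i (g i a) = x i a &
      forall i (b : action i), dev_value (u i) b x <= value (u i) x].
Proof.
move=> x0 z fx.
have st0 : stabilizer u != finset.set0.
  by apply/finset.set0Pn; exists relabeling1; exact: stabilizer1.
have hz : is_simplex z by apply: average_simplex => //; exact: retract_simplex.
have hx : is_simplex x.
  split => // i; apply: (@mulIf _ (nash_den u i z)); first by rewrite gt_eqF ?nash_den_gt0.
  rewrite mulr_suml mul1r -(eq_bigr _ (fun a _ => fx i a)) big_split /=.
  by rewrite hz.2.
have zs g : g \in stabilizer u -> forall i a, z i (g i a) = z i a.
  by move=> gu i a; exact: average_stable.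
have xs g : g \in stabilizer u -> forall i a, x i (g i a) = x i a.
  move=> gu i a; apply: (@mulIf _ (nash_den u i z)); first by rewrite gt_eqF ?nash_den_gt0.
  by rewrite -!fx /nash_num zs // (gain_stable gu) //; exact: zs.
have zx i : z i =1 x i.
  move=> a; rewrite -[RHS](average_id xs) /z /average; congr (_ * _).
  by apply: eq_bigr => g _; exact: retract_id.
split => // i b; have := @nash_fixed_point u z hz; rewrite -(value_ext _ zx).
rewrite -(@dev_value_ext _ _ _ z) => [|j _]; last exact: zx.
by apply => j a; rewrite fx zx.
Qed.

End Vectors.

(** * Equivariant measurable oracles *)

Section RealLimits.
Variable R : realType.
Implicit Types (f g : R^nat).

Lemma cvgn_max f g (a b : R) : f @ \oo --> a -> g @ \oo --> b ->
  (fun n => Num.max (f n) (g n)) @ \oo --> Num.max a b.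
Proof.
have maxE (x y : R) : Num.max x y = (x + y + `|x - y|) * 2^-1.
  by case: (leP x y) => xy; [rewrite ler0_norm | rewrite gtr0_norm]; lra.
move=> fa gb; rewrite maxE (_ : (fun n => _) = (fun n => (f n + g n + `|f n - g n|) * 2^-1)); last first.
  by apply/funext => n; exact: maxE.
apply: cvgM; last exact: cvg_cst.
by apply: cvgD; [exact: cvgD|apply: cvg_norm; exact: cvgB].
Qed.

Lemma cvgn_sum (I : Type) (r : seq I) (P : pred I) (f : I -> R^nat) (l : I -> R) :
  (forall i, f i @ \oo --> l i) ->
  (fun n => \sum_(i <- r | P i) f i n) @ \oo --> \sum_(i <- r | P i) l i.
Proof.
move=> fl; elim: r => [|i r IH].
  by rewrite big_nil; under eq_fun do rewrite big_nil; exact: cvg_cst.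
rewrite big_cons; under eq_fun do rewrite big_cons.
by case: (P i) => //; exact: cvgD.
Qed.

Lemma cvgn_prod (I : Type) (r : seq I) (P : pred I) (f : I -> R^nat) (l : I -> R) :
  (forall i, f i @ \oo --> l i) ->
  (fun n => \prod_(i <- r | P i) f i n) @ \oo --> \prod_(i <- r | P i) l i.
Proof.
move=> fl; elim: r => [|i r IH].
  by rewrite big_nil; under eq_fun do rewrite big_nil; exact: cvg_cst.
rewrite big_cons; under eq_fun do rewrite big_cons.
by case: (P i) => //; exact: cvgM.
Qed.

End RealLimits.

Section Continuity.
Variables (R : realType) (N M : nat) (s : shape N M).
Local Notation vec := (forall i : players s, action i -> R).
Implicit Types (u : payoff R s) (x : vec) (y : nat -> vec).

Definition vcvg y x := forall i (a : action i), (fun k => y k i a) @ \oo --> x i a.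

Lemma vcvg_retract y x : vcvg y x -> vcvg (fun k => retract (y k)) (retract x).
Proof.
move=> yx i a.
have cS : (fun k => \sum_b y k i b) @ \oo --> \sum_b x i b by apply: cvgn_sum => b; exact: yx.
apply: cvgD; apply: cvgM => //.
- apply: cvgV; first by rewrite gt_eqF // lt_max ltr01.
  by apply: cvgn_max => //; exact: cvg_cst.
- by apply: cvgn_max; [exact: cvg_cst|apply: cvgB => //; exact: cvg_cst].
- exact: cvg_cst.
Qed.

Lemma vcvg_average (A : {set relabeling s}) y x :
  vcvg y x -> vcvg (fun k => average A (y k)) (average A x).
Proof.
move=> yx i a; apply: cvgM; first exact: cvg_cst.
by apply: cvgn_sum => g; exact: yx.
Qed.

Lemma cvg_value (w : profile s -> R) y x : vcvg y x -> (fun k => value w (y k)) @ \oo --> value w x.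
Proof.
move=> yx; apply: cvgn_sum => a; apply: cvgM; last exact: cvg_cst.
by apply: cvgn_prod => j; exact: yx.
Qed.

Lemma cvg_dev_value (w : profile s -> R) i (b : action i) y x :
  vcvg y x -> (fun k => dev_value w b (y k)) @ \oo --> dev_value w b x.
Proof.
move=> yx; apply: cvgn_sum => a; apply: cvgM; last exact: cvg_cst.
by apply: cvgn_prod => j; exact: yx.
Qed.

Lemma cvg_gain u i (a : action i) y x : vcvg y x -> (fun k => gain u a (y k)) @ \oo --> gain u a x.
Proof.
move=> yx; apply: cvgn_max; first exact: cvg_cst.
by apply: cvgB; [exact: cvg_dev_value|exact: cvg_value].
Qed.

Lemma cvg_nash_num u i (a : action i) y x :
  vcvg y x -> (fun k => nash_num u a (y k)) @ \oo --> nash_num u a x.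
Proof. by move=> yx; apply: cvgD; [exact: yx|exact: cvg_gain]. Qed.

Lemma cvg_nash_den u i y x :
  vcvg y x -> (fun k => nash_den u i (y k)) @ \oo --> nash_den u i x.
Proof.
move=> yx; apply: cvgD; first exact: cvg_cst.
by apply: cvgn_sum => b; exact: cvg_gain.
Qed.

End Continuity.

Section PayoffMeasurability.
Variables (R : realType) (N M : nat) (s : shape N M).
Local Notation vec := (forall i : players s, action i -> R).
Implicit Types (u : payoff R s) (x : vec).

Lemma measurable_payoff_coord i (a : profile s) :
  measurable_fun setT (fun u : payoff R s => u i a).
Proof.
move=> _ B mB; rewrite setTI; apply: sub_sigma_algebra.
by exists i, a, B.
Qed.

Lemma measurable_to_payoff d (T : measurableType d) (f : T -> payoff R s) :
  (forall i a, measurable_fun setT (fun t => f t i a)) -> measurable_fun setT f.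
Proof.
move=> mf; apply: (@measurability _ _ _ _ _ _ (@payoff_cylinders R N M s)) => //.
move=> _ [_ [i [a [B [mB ->]]]] <-].
by have := mf i a measurableT B mB.
Qed.

Lemma measurable_ler_set d (T : measurableType d) (f g : T -> R) :
  measurable_fun setT f -> measurable_fun setT g -> measurable [set t | f t <= g t].
Proof.
move=> mf mg.
have : measurable (setT `&` (fun t => f t <= g t) @^-1` [set true]).
  by apply: measurable_fun_ler.
by rewrite setTI.
Qed.

Lemma measurable_eqr_set d (T : measurableType d) (f g : T -> R) :
  measurable_fun setT f -> measurable_fun setT g -> measurable [set t | f t = g t].
Proof.
move=> mf mg.
have : measurable (setT `&` (fun t => f t == g t) @^-1` [set true]).
  by apply: measurable_fun_eqr.
rewrite setTI (_ : _ @^-1` _ = [set t | f t = g t]) //.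
by apply/seteqP; split => t /= /eqP.
Qed.

Lemma measurable_payoff_eq d (T : measurableType d) (f g : T -> payoff R s) :
  measurable_fun setT f -> measurable_fun setT g -> measurable [set t | f t = g t].
Proof.
move=> mf mg; rewrite (_ : [set _ | _] = \bigcap_(ia in [set: players s * profile s])
    [set t | f t ia.1 ia.2 = g t ia.1 ia.2]); last first.
  by apply/seteqP; split => t /=; [by move=> fg ia _ /=; rewrite fg|move=> h; apply: payoffP => i a; exact: (h (i, a))].
apply: fin_bigcap_measurable => // ia _; apply: measurable_eqr_set.
  exact: (measurableT_comp (measurable_payoff_coord ia.1 ia.2) mf).
exact: (measurableT_comp (measurable_payoff_coord ia.1 ia.2) mg).
Qed.

Lemma measurable_relabel g : measurable_fun setT (fun u => relabel_payoff u g).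
Proof.
apply: measurable_to_payoff => i a; under eq_fun do rewrite relabel_payoffE.
exact: measurable_payoff_coord.
Qed.

Lemma measurable_value i x : measurable_fun setT (fun u : payoff R s => value (u i) x).
Proof.
apply: measurable_sum => a; apply: measurable_funM; first exact: measurable_cst.
exact: measurable_payoff_coord.
Qed.

Lemma measurable_dev_value i (b : action i) x :
  measurable_fun setT (fun u : payoff R s => dev_value (u i) b x).
Proof.
rewrite /dev_value; under eq_fun do rewrite -big_filter.
apply: measurable_sum => a; apply: measurable_funM; first exact: measurable_cst.
exact: measurable_payoff_coord.
Qed.

Lemma measurable_gain i (a : action i) x : measurable_fun setT (fun u : payoff R s => gain u a x).
Proof.
apply: measurable_maxr; first exact: measurable_cst.
by apply: measurable_funB; [exact: measurable_dev_value|exact: measurable_value].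
Qed.

Lemma measurable_nash_num i (a : action i) x :
  measurable_fun setT (fun u : payoff R s => nash_num u a x).
Proof. by apply: measurable_funD; [exact: measurable_cst|exact: measurable_gain]. Qed.

Lemma measurable_nash_den i x : measurable_fun setT (fun u : payoff R s => nash_den u i x).
Proof.
apply: measurable_funD; first exact: measurable_cst.
by apply: measurable_sum => a; exact: measurable_gain.
Qed.

Lemma measurable_stabilizer : measurable_discrete (fun u => stabilizer u).
Proof.
rewrite (_ : (fun u => _) = (fun u => [set g | [ffun g => relabel_payoff u g == u] g]))%SET; last first.
  by apply/funext => u; apply/setP => g; rewrite !inE ffunE.
apply: (measurable_discrete_select (fun f : {ffun relabeling s -> bool} => [set g | f g]%SET)) => g.
rewrite (_ : [set _ | _] = [set u | relabel_payoff u g = u]).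
  by apply: measurable_payoff_eq; [exact: measurable_relabel|exact: measurable_id].
by apply/seteqP; split => u /= /eqP.
Qed.

End PayoffMeasurability.

(** * Measurable choice of symmetric equilibria *)

Section Selection.
Variables (R : realType) (N M : nat) (s : shape N M).
Local Notation vec := (forall i : players s, action i -> R).
Local Notation coord := {i : players s & action i}.
Local Notation grid p := {ffun coord -> 'I_p.+1}.
Implicit Types (u : payoff R s) (x : vec).

Definition grid_vec p (q : grid p) : vec :=
  fun i a => (q (Tagged (fun i => action i) a))%:R / p%:R.

Definition symmetrized u x := average (stabilizer u) (retract x).

Definition nash_le u x (k : coord) : bool :=
  nash_num u (tagged k) (symmetrized u x) <= x (tag k) (tagged k) * nash_den u (tag k) (symmetrized u x).

Definition nash_ge u x (k : coord) : bool :=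
  x (tag k) (tagged k) * nash_den u (tag k) (symmetrized u x) <= nash_num u (tagged k) (symmetrized u x).

Definition grid_near p (q r : grid p) := [forall i, (q i <= r i <= (q i).+1)%N].

(** The cube with origin [q] brackets a fixed point when, in every coordinate, each of the two
    inequalities holds at some vertex. The vertices may differ, but they merge as the mesh
    shrinks. *)
Definition grid_approx p u (q : grid p) :=
  [forall k, [exists r : grid p, grid_near q r && nash_le u (grid_vec r) k] &&
             [exists r : grid p, grid_near q r && nash_ge u (grid_vec r) k]].

Lemma grid_vec_ge0 p (q : grid p) i (a : action i) : 0 <= grid_vec q a.
Proof. by rewrite divr_ge0 ?ler0n. Qed.

Lemma symmetrized_simplex u x : (forall i a, 0 <= x i a) -> is_simplex (symmetrized u x).
Proof.
move=> x0; apply: average_simplex; last exact: retract_simplex.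
by apply/finset.set0Pn; exists (relabeling1 s); exact: stabilizer1.
Qed.

Lemma grid_approx_exists p u : exists q : grid p.+1, grid_approx u q.
Proof.
(* Kuhn's lemma wants the label false on the face at 0, so this is forced. Nothing is lost: the
   coordinate being 0 there, [nash_ge] holds anyway. *)
pose lab (k : coord) (q : grid p.+1) := (q k != ord0) && nash_le u (grid_vec q) k.
have [//|k q qk|k q qk|q hq] := @kuhn _ p.+1 lab.
- by rewrite /lab qk eqxx.
- rewrite /lab qk /= /nash_le /grid_vec; case: k qk => i a /= ->.
  rewrite divff ?mul1r ?pnatr_eq0 //; apply: nash_num_le.
  by apply: symmetrized_simplex => j b; exact: grid_vec_ge0.
exists q; apply/forallP => k; have [r [r' [nr nr' lr lr']]] := hq k.
apply/andP; split; apply/existsP.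
  by exists r'; apply/andP; split; [apply/forallP|case/andP: lr'].
exists r; apply/andP; split; first exact/forallP.
move: lr; rewrite /lab negb_and negbK => /orP[/eqP rk|]; last by rewrite /nash_le -ltNge => /ltW.
rewrite /nash_ge /grid_vec; case: k rk {nr nr' lr' hq r'} => i a /= ->.
rewrite mul0r mul0r; apply: addr_ge0; last exact: gain_ge0.
by apply: (symmetrized_simplex _ _).1 => j b; exact: grid_vec_ge0.
Qed.

Lemma measurable_symmetrized_num x i (a : action i) :
  measurable_fun setT (fun u => nash_num u a (symmetrized u x)).
Proof.
apply: (measurable_fun_discrete (h := fun u => stabilizer u)
  (G := fun A u => nash_num u a (average A (retract x)))).
  exact: measurable_stabilizer.
by move=> A; exact: measurable_nash_num.
Qed.

Lemma measurable_symmetrized_den x i :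
  measurable_fun setT (fun u => nash_den u i (symmetrized u x)).
Proof.
apply: (measurable_fun_discrete (h := fun u => stabilizer u)
  (G := fun A u => nash_den u i (average A (retract x)))).
  exact: measurable_stabilizer.
by move=> A; exact: measurable_nash_den.
Qed.

Lemma measurable_nash_le x k : measurable [set u | nash_le u x k].
Proof.
apply: measurable_ler_set; first exact: measurable_symmetrized_num.
by apply: measurable_funM; [exact: measurable_cst|exact: measurable_symmetrized_den].
Qed.

Lemma measurable_nash_ge x k : measurable [set u | nash_ge u x k].
Proof.
apply: measurable_ler_set; last exact: measurable_symmetrized_num.
by apply: measurable_funM; [exact: measurable_cst|exact: measurable_symmetrized_den].
Qed.

Lemma measurable_exists_fin d (T : measurableType d) (F : finType) (P : F -> T -> bool) :
  (forall q, measurable [set t | P q t]) -> measurable [set t | [exists q, P q t]].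
Proof.
move=> mP; rewrite (_ : [set _ | _] = \bigcup_(q in [set: F]) [set t | P q t]).
  by apply: fin_bigcup_measurable => // q _; exact: mP.
apply/seteqP; split => t /=; first by move=> /existsP[q]; exists q.
by move=> [q _ Pq]; apply/existsP; exists q.
Qed.

Lemma measurable_forall_fin d (T : measurableType d) (F : finType) (P : F -> T -> bool) :
  (forall q, measurable [set t | P q t]) -> measurable [set t | [forall q, P q t]].
Proof.
move=> mP; rewrite (_ : [set _ | _] = \bigcap_(q in [set: F]) [set t | P q t]).
  by apply: fin_bigcap_measurable => // q _; exact: mP.
apply/seteqP; split => t /=; first by move=> /forallP h q _; exact: h.
by move=> h; apply/forallP => q; exact: h.
Qed.

Lemma measurable_andb d (T : measurableType d) (P Q : T -> bool) :
  measurable [set t | P t] -> measurable [set t | Q t] -> measurable [set t | P t && Q t].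
Proof.
move=> mP mQ; rewrite (_ : [set _ | _] = [set t | P t] `&` [set t | Q t]); first exact: measurableI.
by apply/seteqP; split => t /= /andP.
Qed.

Lemma measurable_const_bool d (T : measurableType d) (b : bool) : measurable [set _ : T | b].
Proof.
case: b; first by rewrite (_ : [set _ | _] = setT) //; apply/seteqP; split.
by rewrite (_ : [set _ | _] = set0) //; apply/seteqP; split.
Qed.

Lemma measurable_grid_approx p (q : grid p) : measurable [set u | grid_approx u q].
Proof.
apply: measurable_forall_fin => k; apply: measurable_andb; apply: measurable_exists_fin => r;
  (apply: measurable_andb; first exact: measurable_const_bool).
- exact: measurable_nash_le.
- exact: measurable_nash_ge.
Qed.

Definition grid_select p u : grid p := odflt [ffun=> ord0] [pick q | grid_approx u q].

Lemma grid_selectP p u : grid_approx u (grid_select p.+1 u).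
Proof.
rewrite /grid_select; case: pickP => //= h.
by have [q] := grid_approx_exists p u; rewrite h.
Qed.

Lemma measurable_grid_select p : measurable_discrete (grid_select p).
Proof.
rewrite (_ : grid_select p = fun u => odflt [ffun=> ord0] [pick q | [ffun q => grid_approx u q] q]); last first.
  apply/funext => u; congr odflt; apply: eq_pick => q; by rewrite ffunE.
apply: (measurable_discrete_select (fun f : {ffun grid p -> bool} => odflt [ffun=> ord0] [pick q | f q])) => q.
exact: measurable_grid_approx.
Qed.

Lemma measurable_symmetric_nash : exists y : payoff R s -> vec,
  (forall i (a : action i), measurable_fun setT (fun u => y u i a)) /\
  forall u, [/\ is_simplex (y u),
    forall g, g \in stabilizer u -> forall i a, y u i (g i a) = y u i a &
    forall i (b : action i), dev_value (u i) b (y u) <= value (u i) (y u)].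
Proof.
(* The origin of the chosen bracketing cube in the grid of mesh [1/(n+1)]. *)
pose z n u (k : coord) := grid_vec (grid_select n.+1 u) (tagged k).
have mz n k : measurable_fun setT (fun u => z n u k).
  apply: (measurable_fun_discrete (h := grid_select n.+1) (G := fun q _ => grid_vec q (tagged k))).
    exact: measurable_grid_select.
  by move=> q; exact: measurable_cst.
have z01 n u k : 0 <= z n u k <= 1.
  rewrite grid_vec_ge0 /= /z /grid_vec ler_pdivrMr ?ltr0n // mul1r ler_nat -ltnS.
  exact: ltn_ord.
have [y [m [my km ym]]] := measurable_cluster mz z01.
exists (fun u i a => y u (Tagged (fun i => action i) a)); split; first by move=> i a; exact: my.
move=> u; set x : vec := fun i a => _.
pose q k := grid_select (m u k).+1 u.
have qx : vcvg (fun k => grid_vec (q k)) x.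
  by move=> i a; exact: (ym u (Tagged (fun i => action i) a)).
(* A vertex differs from the origin of its cube by at most the mesh in each coordinate, so every
   choice of vertices tends to [x]. *)
have near_cvg (r : forall k, grid (m u k).+1) :
    (forall k, grid_near (q k) (r k)) -> vcvg (fun k => grid_vec (r k)) x.
  move=> qr i a.
  have e0 : (fun k => (m u k).+1%:R^-1 : R) @ \oo --> (0 : R).
    exact: (cvgn_subseq (km u) (@cvg_harmonic R)).
  have qe : (fun k => grid_vec (q k) a + (m u k).+1%:R^-1) @ \oo --> x i a.
    by rewrite -[x i a]addr0; apply: cvgD => //; exact: qx.
  apply: (squeeze_cvgr _ (qx i a) qe); apply: nearW => k.
  have /forallP/(_ (Tagged (fun i => action i) a))/andP[h1 h2] := qr k.
  rewrite /grid_vec ler_pM2r ?invr_gt0 ?ltr0n // ler_nat h1 /=.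
  by rewrite -[X in _ + X]mul1r -mulrDl ler_pM2r ?invr_gt0 ?ltr0n // natr1 ler_nat.
have sym_cvg (r : nat -> vec) : vcvg r x -> vcvg (fun k => symmetrized u (r k)) (symmetrized u x).
  by move=> rx; apply: vcvg_average; exact: vcvg_retract.
have approx k : grid_approx u (q k) by exact: grid_selectP.
have x_ge0 i a : 0 <= x i a.
  apply: (@ler_cvg_to _ \oo _ R (fun=> 0) _ _ _ _ (qx i a)); first exact: cvg_cst.
  by apply: nearW => k; exact: grid_vec_ge0.
(* For fixed [u] and each of the two inequalities, vertices satisfying it form a sequence tending to
   [x]. By continuity both inequalities hold at [x], which gives the equation. *)
apply: nash_symmetric_fixed_point => // i a; apply/eqP; rewrite eq_le; apply/andP; split.
- have hr k : exists r : grid (m u k).+1, grid_near (q k) r && nash_le u (grid_vec r) (Tagged (fun i => action i) a).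
    by apply/existsP; have /forallP/(_ (Tagged (fun i => action i) a))/andP[] := approx k.
  pose r k := xchoose (hr k).
  have rx : vcvg (fun k => grid_vec (r k)) x.
    by apply: near_cvg => k; case/andP: (xchooseP (hr k)).
  apply: (@ler_cvg_to _ \oo _ R _ _ _ _ (@cvg_nash_num _ _ _ _ u i a _ _ (sym_cvg _ rx))
    (cvgM (rx i a) (@cvg_nash_den _ _ _ _ u i _ _ (sym_cvg _ rx)))).
  by apply: nearW => k; case/andP: (xchooseP (hr k)).
- have hr k : exists r : grid (m u k).+1, grid_near (q k) r && nash_ge u (grid_vec r) (Tagged (fun i => action i) a).
    by apply/existsP; have /forallP/(_ (Tagged (fun i => action i) a))/andP[] := approx k.
  pose r k := xchoose (hr k).
  have rx : vcvg (fun k => grid_vec (r k)) x.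
    by apply: near_cvg => k; case/andP: (xchooseP (hr k)).
  apply: (@ler_cvg_to _ \oo _ R _ _ _ _ (cvgM (rx i a) (@cvg_nash_den _ _ _ _ u i _ _ (sym_cvg _ rx)))
    (@cvg_nash_num _ _ _ _ u i a _ _ (sym_cvg _ rx))).
  by apply: nearW => k; case/andP: (xchooseP (hr k)).
Qed.

End Selection.

Lemma measurable_lexi d (T : measurableType d) (R : realType) (I : Type) (r : seq I)
    (f g : I -> T -> R) :
  (forall i, measurable_fun setT (f i)) -> (forall i, measurable_fun setT (g i)) ->
  measurable [set t | ([seq f i t | i <- r] <= [seq g i t | i <- r] :> seqlexi R)%O].
Proof.
move=> mf mg; elim: r => [|i r IH] /=; first exact: measurable_const_bool.
rewrite (_ : [set _ | _] = [set t | f i t <= g i t] `&`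
    (~` [set t | g i t <= f i t] `|` [set t | ([seq f i t | i <- r] <= [seq g i t | i <- r] :> seqlexi R)%O])).
  apply: measurableI; first exact: measurable_ler_set.
  by apply: measurableU => //; apply: measurableC; exact: measurable_ler_set.
apply/seteqP; split => t /=.
  rewrite lexi_cons => /andP[-> /implyP h]; split => //.
  by case: (boolP (g i t <= f i t)) => [/h|/negP]; [right|left].
rewrite lexi_cons => -[-> [/negP/negbTE -> //|->]].
exact: implybT.
Qed.

(** * Canonical payoffs in relabelling orbits *)

Section Canonical.
Variables (R : realType) (N M : nat) (s : shape N M).
Local Notation vec := (forall i : players s, action i -> R).
Implicit Types (u : payoff R s) (x : vec) (g h : relabeling s).

Definition payoff_code u : seqlexi R :=
  [seq u ia.1 ia.2 | ia <- enum {: players s * profile s}].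

Lemma payoff_code_inj : injective payoff_code.
Proof.
move=> u v uv; apply: payoffP => i a.
by have /eq_in_map/(_ (i, a)) := uv; apply; rewrite mem_enum.
Qed.

Definition canonical u : relabeling s :=
  odflt (relabeling1 s) [pick g | [forall h,
    (payoff_code (relabel_payoff u g) <= payoff_code (relabel_payoff u h))%O]].

Lemma canonicalP u h :
  (payoff_code (relabel_payoff u (canonical u)) <= payoff_code (relabel_payoff u h))%O.
Proof.
rewrite /canonical; case: pickP => [g /forallP //|/= hn].
have [g _ hg] := Order.TotalTheory.arg_minP (fun g => payoff_code (relabel_payoff u g))
  (isT : xpredT (relabeling1 s)).
by have /forallP[] := negbT (hn g) => k; exact: hg.
Qed.

(** The minimizing relabelling need not be unique, but the minimal code is the same all over the
    orbit and determines the payoff. *)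
Lemma canonical_orbit u h :
  relabel_payoff (relabel_payoff u h) (canonical (relabel_payoff u h)) =
  relabel_payoff u (canonical u).
Proof.
apply: payoff_code_inj; apply/le_anti/andP; split.
  have := canonicalP (relabel_payoff u h) (relabeling_comp (relabeling_inv h) (canonical u)).
  by rewrite [X in (_ <= payoff_code X)%O]relabel_payoff_comp relabeling_compA relabeling_compV relabeling_1comp.
by rewrite relabel_payoff_comp; exact: canonicalP.
Qed.

Lemma measurable_canonical : measurable_discrete canonical.
Proof.
pose P g u := [forall h, (payoff_code (relabel_payoff u g) <= payoff_code (relabel_payoff u h))%O].
rewrite (_ : canonical = fun u => odflt (relabeling1 s) [pick g | [ffun g => P g u] g]); last first.
  by apply/funext => u; congr odflt; apply: eq_pick => g; rewrite ffunE.
apply: (measurable_discrete_select (fun f : {ffun relabeling s -> bool} => odflt (relabeling1 s) [pick g | f g])) => g.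
apply: measurable_forall_fin => h.
by apply: measurable_lexi => ia; exact: (measurableT_comp (measurable_payoff_coord _ _) (measurable_relabel _)).
Qed.

Lemma relabel_vec_simplex x g : is_simplex x -> is_simplex (relabel_vec x g).
Proof.
move=> [x0 x1]; split=> i; first by move=> a; exact: x0.
by rewrite -(x1 i) [RHS](reindex_inj (@perm_inj _ (g i))).
Qed.

(* Select an equilibrium at the lexicographically least payoff of each orbit and
   transport it; invariance under stabilizers makes this well defined. *)
Lemma equivariant_nash : exists F : payoff R s -> strategy R s,
  [/\ forall i (a : action i), measurable_fun setT (fun u => F u i a),
      forall u, is_nash u (F u) &
      forall u g i (a : action i), F (relabel_payoff u g) i a = F u i (g i a)].
Proof.
have [y [my hy]] := measurable_symmetric_nash R s.
pose f u : vec := relabel_vec (y (relabel_payoff u (canonical u))) (relabeling_inv (canonical u)).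
have fs u : is_simplex (f u) by apply: relabel_vec_simplex; case: (hy (relabel_payoff u (canonical u))).
exists (fun u => to_strategy (fs u)); split.
- move=> i a; under eq_fun do rewrite to_strategyE.
  apply: (measurable_fun_discrete (h := canonical)
    (G := fun g u => y (relabel_payoff u g) i (relabeling_inv g i a))).
    exact: measurable_canonical.
  by move=> g; exact: (measurableT_comp (my _ _) (measurable_relabel g)).
- move=> u; apply: nashP => i b; set k := canonical u; set v := relabel_payoff u k.
  have uE : u = relabel_payoff v (relabeling_inv k).
    by rewrite /v relabel_payoff_comp relabeling_compV relabel_payoff1.
  have fE j : (fun a => to_strategy (fs u) j a) =1 f u j by move=> a; exact: to_strategyE.
  rewrite utilityE (value_ext _ fE) (@dev_value_ext _ _ _ _ _ _ _ _ (f u)); last by move=> j _; exact: fE.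
  rewrite {1 3}uE dev_value_relabel value_relabel.
  by case: (hy v).
move=> u g i a; rewrite !to_strategyE /f /relabel_vec.
rewrite canonical_orbit; set v := relabel_payoff u _.
set k := canonical u; set k' := canonical _.
(* A closed path: from [v] to [u] by the inverse of [k], on to the relabelled payoff by [g], and
   back to [v] by [k']. *)
have kv : relabeling_comp (relabeling_inv k) (relabeling_comp g k') \in stabilizer v.
  have vk : relabel_payoff v (relabeling_inv k) = u.
    by rewrite /v relabel_payoff_comp relabeling_compV relabel_payoff1.
  by rewrite inE -relabel_payoff_comp vk -relabel_payoff_comp canonical_orbit.
have [_ /(_ _ kv i (relabeling_inv k' i a)) <- _] := hy v.
by congr (y v i _); rewrite !ffunE !permM permKV.
Qed.

End Canonical.

Section Oracle.
Variables (R : realType) (N M : nat).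

Definition relabeling_single (s : shape N M) (i : players s) (rho : {perm action i}) : relabeling s :=
  finfun (dfwith (fun j => 1%g : {perm action j}) i rho).

Lemma relabeling_single_same (s : shape N M) (i : players s) (rho : {perm action i}) :
  relabeling_single rho i = rho.
Proof. by rewrite ffunE dfwithin. Qed.

Lemma relabeling_single_other (s : shape N M) (i j : players s) (rho : {perm action i}) :
  i != j -> relabeling_single rho j = 1%g.
Proof. by move=> ij; rewrite ffunE dfwithout. Qed.

Lemma perm_payoffE (s : shape N M) (i : players s) (rho : {perm action i}) (u : payoff R s) :
  perm_payoff rho u = relabel_payoff u (relabeling_single rho^-1%g).
Proof.
apply: payoffP => j a; rewrite relabel_payoffE !ffunE; congr (u j _).
apply/ffunP => k; rewrite !ffunE.
have [ik|ik] := eqVneq i k; first by subst k; rewrite !dfwithin.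
by rewrite !dfwithout // perm1.
Qed.

Lemma equivariant_both (f : approximator R N M) : measurable_approximator f ->
  (forall s (u : payoff R s) g i (a : action i), f s (relabel_payoff u g) i a = f s u i (g i a)) ->
  NE_both f.
Proof.
move=> mf hf; split; split => //= s i rho.
  move=> j u ji; apply/val_inj/ffunP => a; rewrite perm_payoffE.
  by rewrite [LHS]hf relabeling_single_other ?perm1 // eq_sym.
move=> u; apply/val_inj/ffunP => a; rewrite perm_payoffE [RHS]ffunE.
by rewrite [LHS]hf relabeling_single_same.
Qed.

Lemma oracle_both_exists : exists f : approximator R N M, oracle_both f.
Proof.
pose f : approximator R N M := fun s => projT1 (cid (equivariant_nash R s)).
have hf (s : shape N M) := projT2 (cid (equivariant_nash R s)).
have mf : NE_general f by move=> s i a; have [+ _ _] := hf s; exact.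
exists f; split; first by split => // s u; have [_ + _] := hf s; exact.
by apply: equivariant_both => // s; have [_ _ +] := hf s; exact.
Qed.

End Oracle.

(** * Welfare ratios *)

Section UniformDirac.
Context d (T : measurableType d) (R : realType).
Variables (n : nat) (g : nat -> T).

Definition sum_dirac : set T -> \bar R :=
  msum (fun k => @dirac _ T (g k) R : {measure set T -> \bar R}) n.+1.
HB.instance Definition _ := Measure.on sum_dirac.

Lemma uniform_weight_ge0 : 0 <= (n.+1%:R^-1 : R).
Proof. by rewrite invr_ge0 ler0n. Qed.

Definition uniform_dirac : set T -> \bar R := mscale (NngNum uniform_weight_ge0) sum_dirac.
HB.instance Definition _ := Measure.on uniform_dirac.

Lemma uniform_dirac_setT : uniform_dirac setT = 1%E.
Proof.
rewrite /uniform_dirac /mscale /= /sum_dirac /msum (eq_bigr (fun=> 1%E)); last first.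
  by move=> k _; exact: diracT.
by rewrite sumEFin sumr_const card_ord -EFinM mulVf // pnatr_eq0.
Qed.

HB.instance Definition _ := Measure_isProbability.Build _ _ _ uniform_dirac uniform_dirac_setT.

Lemma expectation_uniform_dirac (X : T -> R) : measurable_fun setT X -> (forall t, 0 <= X t) ->
  'E_uniform_dirac[X]%E = (n.+1%:R^-1 * \sum_(k < n.+1) X (g k))%:E.
Proof.
move=> mX X0; have mE : measurable_fun setT (EFin \o X) by exact/measurable_EFinP.
rewrite unlock ge0_integral_mscale //=; last by move=> t _; rewrite lee_fin.
transitivity ((n.+1%:R^-1)%:E * \sum_(k < n.+1) \int[@dirac _ T (g k) R]_t (X t)%:E)%E.
  congr (_ * _)%E.
  have XE0 t : setT t -> (0 <= (EFin \o X) t)%E by move=> _; rewrite lee_fin.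
  exact: (ge0_integral_measure_sum (fun k => @dirac _ T (g k) R : {measure set T -> \bar R})
    measurableT XE0 mE n.+1).
rewrite [RHS]EFinM -sumEFin; congr (_ * _)%E; apply: eq_bigr => k _.
by rewrite integral_dirac // diracT mul1e.
Qed.

End UniformDirac.

Lemma uniform_probability d (T : measurableType d) (R : realType) (C : finType) (c0 : C) (g : C -> T) :
  exists D : probability T R, forall X : T -> R, measurable_fun setT X -> (forall t, 0 <= X t) ->
    'E_D[X]%E = (#|C|%:R^-1 * \sum_c X (g c))%:E.
Proof.
have C0 : (0 < #|C|)%N by apply/card_gt0P; exists c0.
exists (uniform_dirac R #|C|.-1 (fun k => g (nth c0 (enum C) k))) => X mX X0.
rewrite expectation_uniform_dirac // prednK //; congr ((_ * _)%:E).
rewrite -[in RHS]big_enum /= (big_nth c0) big_mkord -cardE.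
by apply: eq_bigr.
Qed.

Section Ratio.
Variables (R : realType) (N M : nat) (hN : (2 <= N)%N) (hM : (2 <= M)%N).
Implicit Types (f : approximator R N M) (F : set (approximator R N M)).
Local Notation game := (game R hN hM).
Local Open Scope ereal_scope.

Definition welfare f (g : game) : R := social_welfare (f (tag g) (tagged g)) (tagged g).

Lemma welfare_ge0 f g : (0 <= welfare f g)%R.
Proof.
rewrite /welfare social_welfareE; apply: value_ge0; first exact: strategy_simplex.
move=> a; apply: sumr_ge0 => i _; case: (tagged g) => u /= /forallP/(_ i)/forallP/(_ a).
by case/andP.
Qed.

Lemma welfare_le f g : (welfare f g <= N%:R)%R.
Proof.
rewrite /welfare social_welfareE; apply: value_le; first exact: strategy_simplex.
move=> a; apply: (@le_trans _ _ (\sum_(i : players (tag g)) 1)%R).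
  apply: ler_sum => i _; case: (tagged g) => u /= /forallP/(_ i)/forallP/(_ a).
  by case/andP.
by rewrite sumr_const card_ord ler_nat -ltnS ltn_ord.
Qed.

Lemma measurable_welfare f : measurable_approximator f -> measurable_fun setT (welfare f).
Proof.
move=> mf _ B mB; rewrite setTI.
suff : game_measurable (welfare f @^-1` B) by [].
move=> s.
have ms : measurable_fun setT (fun u : payoff R s => social_welfare (f s u) u).
  apply: measurable_sum => i; apply: measurable_sum => a; apply: measurable_funM.
    by apply: measurable_prod => j _; exact: mf.
  exact: measurable_payoff_coord.
by rewrite -[X in measurable X]setTI; exact: ms.
Qed.

Lemma expected_welfareE D f : @expected_welfare R N M hN hM D f = \int[D]_g (welfare f g)%:E.
Proof. by rewrite /expected_welfare unlock. Qed.

Lemma expected_welfare_ge0 D f : 0 <= @expected_welfare R N M hN hM D f.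
Proof. by rewrite expected_welfareE; apply: integral_ge0 => g _; rewrite lee_fin welfare_ge0. Qed.

Lemma expected_welfare_le D f f' c : measurable_approximator f -> measurable_approximator f' ->
  (0 <= c)%R -> (forall g, welfare f g <= c * welfare f' g)%R ->
  @expected_welfare R N M hN hM D f <= c%:E * @expected_welfare R N M hN hM D f'.
Proof.
move=> mf mf' c0 ff'; rewrite !expected_welfareE.
have mE h : measurable_approximator h -> measurable_fun setT (fun g => (welfare h g)%:E).
  by move=> mh; apply/measurable_EFinP; exact: measurable_welfare.
rewrite -ge0_integralZl //; [|exact: mE|by move=> g _; rewrite lee_fin welfare_ge0].
apply: ge0_le_integral => //.
- by move=> g _; rewrite lee_fin welfare_ge0.
- exact: mE.
- by apply: measurable_funeM; exact: mE.
- by move=> g _; rewrite -EFinM lee_fin.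
Qed.

Lemma expected_welfare_le_cst D f : measurable_approximator f ->
  @expected_welfare R N M hN hM D f <= N%:R%:E.
Proof.
move=> mf; rewrite expected_welfareE.
apply: (@le_trans _ _ (\int[D]_g cst (N%:R%:E : \bar R) g)); last first.
  by rewrite integral_cst // [X in _ * X](@probability_setT _ _ _ D) mule1.
apply: ge0_le_integral => //.
- by move=> g _; rewrite lee_fin welfare_ge0.
- by apply/measurable_EFinP; exact: measurable_welfare.
- by move=> g _; rewrite lee_fin welfare_le.
Qed.

Lemma SWR_le F1 F2 (D : probability game R) (a b : R) : (0 <= a)%R -> (0 < b)%R ->
  best_welfare F1 D <= a%:E -> b%:E <= best_welfare F2 D -> SWR hN hM F1 F2 <= (a / b)%:E.
Proof.
move=> a0 b0 F1a F2b.
have F20 : 0 < best_welfare F2 D by apply: lt_le_trans F2b; rewrite lte_fin.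
apply: (@le_trans _ _ (best_welfare F1 D / best_welfare F2 D)).
  by apply: ereal_inf_lbound; exists D.
have iF2 : (best_welfare F2 D)^-1 <= b^-1%:E.
  have -> : b^-1%:E = (b%:E)^-1 by rewrite inver gt_eqF.
  by rewrite lee_pV2 // !inE ?lee_fin ltW.
apply: (@le_trans _ _ (a%:E * (best_welfare F2 D)^-1)).
  by apply: lee_wpmul2r => //; rewrite inve_ge0 ltW.
by rewrite EFinM; apply: lee_wpmul2l; rewrite ?lee_fin.
Qed.

Lemma le_SWR F1 F2 (c : R) : (0 < c)%R -> F2 `<=` NE_general ->
  (forall D : probability game R, best_welfare F2 D <= c%:E * best_welfare F1 D) ->
  c^-1%:E <= SWR hN hM F1 F2.
Proof.
move=> c0 F2g h; apply: le_ereal_inf_tmp => _ [D /= F20 <-].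
(* Welfare is at most [N], so the denominator is finite and can be cleared from the quotient of
   extended reals. *)
have F2N : best_welfare F2 D <= N%:R%:E.
  by apply: ge_ereal_sup => _ [f /F2g mf <-]; exact: expected_welfare_le_cst.
have := h D; case: (best_welfare F2 D) F20 F2N => [y| |] //; rewrite lte_fin => y0 _ hy.
rewrite inver gt_eqF // lee_pdivlMr // -EFinM mulrC.
by rewrite EFinM muleC lee_pdivrMl // muleC.
Qed.

Lemma best_welfare_subset F1 F2 (D : probability game R) : F1 `<=` F2 ->
  best_welfare F1 D <= best_welfare F2 D.
Proof. by move=> F12; apply: ereal_sup_le => _ [f Ff <-]; exists f => //; exact: F12. Qed.

Lemma SWR_subset F1 F1' F2 : F1 `<=` F1' -> SWR hN hM F1 F2 <= SWR hN hM F1' F2.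
Proof.
move=> F11; apply: le_ereal_inf_tmp => _ [D /= F20 <-].
apply: (@le_trans _ _ (best_welfare F1 D / best_welfare F2 D)).
  by apply: ereal_inf_lbound; exists D.
by apply: lee_wpmul2r; [rewrite inve_ge0 ltW|exact: best_welfare_subset].
Qed.

Lemma best_welfare_ge F f (D : probability game R) : F f ->
  @expected_welfare R N M hN hM D f <= best_welfare F D.
Proof. by move=> Ff; apply: ereal_sup_ubound; exists f. Qed.

Lemma SWR_ge0 F1 F2 f : F1 f -> 0 <= SWR hN hM F1 F2.
Proof.
move=> F1f; apply: le_ereal_inf_tmp => _ [D /= F20 <-].
apply: mule_ge0; last by rewrite inve_ge0 ltW.
by apply: le_trans (best_welfare_ge D F1f); exact: expected_welfare_ge0.
Qed.

End Ratio.

Section Equivariant.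
Variables (R : realType) (N M : nat).
Implicit Types f : approximator R N M.

Lemma PPE_relabel f s (u : payoff R s) i (rho : {perm action i}) a : is_PPE f ->
  f s (relabel_payoff u (relabeling_single rho)) i a = f s u i (rho a).
Proof.
move=> hf; have := hf s i (rho^-1)%g u; rewrite perm_payoffE invgK => ->.
by rewrite /= ffunE invgK.
Qed.

(** OPI concerns one relabelled player at a time. [t r] restricts [g] to the players in [r], who are
    removed one by one; player [i] contributes the identity. *)
Lemma OPI_relabel f s (u : payoff R s) (g : relabeling s) i : is_OPI f -> g i = 1%g ->
  f s (relabel_payoff u g) i = f s u i.
Proof.
move=> hf gi; pose t (r : seq (players s)) : relabeling s :=
  finfun (fun j => if j \in r then g j else 1%g).
have -> : g = t (enum (players s)) by apply/ffunP => j; rewrite ffunE mem_enum.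
have : uniq (enum (players s)) by exact: enum_uniq.
elim: (enum _) u => [|j r IH] u.
  by move=> _; rewrite (_ : t [::] = relabeling1 s) ?relabel_payoff1.
rewrite cons_uniq => /andP[jr ur].
have -> : t (j :: r) = relabeling_comp (relabeling_single (g j)) (t r).
  apply/ffunP => k; rewrite !ffunE inE.
  have [->|kj] := eqVneq k j; first by rewrite dfwithin (negbTE jr) mul1g.
  by rewrite dfwithout 1?eq_sym // mulg1.
rewrite -relabel_payoff_comp IH //.
have [E|ij] := eqVneq i j; last first.
  by have := hf s j ((g j)^-1)%g i u ij; rewrite perm_payoffE invgK.
subst j; rewrite gi (_ : relabeling_single 1%g = relabeling1 s) ?relabel_payoff1 //.
apply/ffunP => k; rewrite !ffunE.
have [E|ik] := eqVneq i k; first by subst k; rewrite dfwithin.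
by rewrite dfwithout.
Qed.

(** The relabelling splits into that of the other players, invisible by OPI, and the player's own,
    handled by PPE. *)
Lemma both_relabel f s (u : payoff R s) (g : relabeling s) i (a : action i) :
  is_OPI f -> is_PPE f -> f s (relabel_payoff u g) i a = f s u i (g i a).
Proof.
move=> hO hP; pose g' : relabeling s := finfun (fun j => if j == i then 1%g else g j).
have -> : g = relabeling_comp g' (relabeling_single (g i)).
  apply/ffunP => k; rewrite !ffunE.
  have [->|ki] := eqVneq k i; first by rewrite dfwithin mulg1.
  by rewrite dfwithout 1?eq_sym // mul1g.
rewrite -relabel_payoff_comp PPE_relabel // OPI_relabel //; last by rewrite ffunE eqxx.
by congr (f s u i _); rewrite !ffunE dfwithin eqxx mulg1.
Qed.

End Equivariant.

(** * Welfare-maximizing and leader approximators *)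

Section Approximators.
Variables (R : realType) (N M : nat).

Section Shape.
Variable s : shape N M.
Local Notation vec := (forall i : players s, action i -> R).
Implicit Types (u : payoff R s) (x : vec) (p : profile s).

Lemma players_gt0 : (0 < tag (shape_val s))%N.
Proof. by case: (s) => v /= /andP[/ltnW]. Qed.

Definition player0 : players s := Ordinal players_gt0.

Definition profile0 : profile s := finfun (fun i => enum_val (Ordinal (action_gt0 i))).

Definition pure p : strategy R s := fun i => delta R (p i).

Lemma value_pure (w : profile s -> R) p : value w (fun i => pure p i) = w p.
Proof.
rewrite /value (bigD1 p) //= [X in _ + X]big1 => [|q qp].
  by rewrite addr0 big1 ?mul1r // => j _; rewrite ffunE eqxx.
have [j qj] : exists j, q j != p j.
  by apply/existsP; apply: contraNT qp => /existsPn h; apply/eqP/ffunP => j; apply/eqP; have := h j; rewrite negbK.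
by rewrite (bigD1 j) //= ffunE (negbTE qj) !mul0r.
Qed.

Definition total_payoff u p : R := \sum_i u i p.

Lemma social_welfare_pure u p : social_welfare (pure p) u = total_payoff u p.
Proof. by rewrite social_welfareE value_pure. Qed.

Lemma measurable_total_payoff p : measurable_fun setT (total_payoff^~ p).
Proof. by apply: measurable_sum => i; exact: measurable_payoff_coord. Qed.

Definition max_profile u : profile s :=
  odflt profile0 [pick p | [forall q, total_payoff u q <= total_payoff u p]].

Lemma max_profileP u q : total_payoff u q <= total_payoff u (max_profile u).
Proof.
rewrite /max_profile; case: pickP => [p /forallP //|/= hn].
have [p _ hp] := Order.TotalTheory.arg_maxP (total_payoff u) (isT : xpredT profile0).
by have /forallP[] := negbT (hn p) => q'; exact: hp.
Qed.

Lemma measurable_max_profile : measurable_discrete max_profile.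
Proof.
pose P p u := [forall q, total_payoff u q <= total_payoff u p].
rewrite (_ : max_profile = fun u => odflt profile0 [pick p | [ffun p => P p u] p]); last first.
  by apply/funext => u; congr odflt; apply: eq_pick => p; rewrite ffunE.
apply: (measurable_discrete_select (fun f : {ffun profile s -> bool} => odflt profile0 [pick p | f p])) => p.
by apply: measurable_forall_fin => q; apply: measurable_ler_set; exact: measurable_total_payoff.
Qed.

Definition marginal u i (a : action i) : R := \sum_(p : profile s | p i == a) total_payoff u p.

Lemma marginal_relabel u g i (a : action i) : marginal (relabel_payoff u g) a = marginal u (g i a).
Proof.
rewrite [RHS](reindex (relabel g)); last exact/onW_bij/relabel_bij.
apply: eq_big => p; first by rewrite ffunE (inj_eq perm_inj).
by move=> _; apply: eq_bigr => j _; rewrite relabel_payoffE.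
Qed.

(** All maximizers are kept, since singling one out would break equivariance when there are ties. *)
Definition best_actions u i : {set action i} := [set a | [forall b : action i, marginal u b <= marginal u a]]%SET.

Lemma best_actions_gt0 u i : (0 < #|best_actions u i|)%N.
Proof.
have [a _ ha] := Order.TotalTheory.arg_maxP (@marginal u i) (isT : xpredT (enum_val (Ordinal (action_gt0 i)))).
by apply/card_gt0P; exists a; rewrite inE; apply/forallP => b; exact: ha.
Qed.

Lemma best_actions_relabel u g i (a : action i) :
  (a \in best_actions (relabel_payoff u g) i) = (g i a \in best_actions u i).
Proof.
rewrite !inE; apply/forallP/forallP => h b.
  by have := h ((g i)^-1%g b); rewrite !marginal_relabel permKV.
by rewrite !marginal_relabel.
Qed.

Lemma card_best_actions_relabel u g i :
  #|best_actions (relabel_payoff u g) i| = #|best_actions u i|.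
Proof.
rewrite -!sum1_card [RHS](reindex_inj (@perm_inj _ (g i))) /=.
by apply: eq_bigl => a; rewrite best_actions_relabel.
Qed.

Lemma measurable_best_actions i : measurable_discrete (best_actions^~ i).
Proof.
pose P a u := [forall b : action i, marginal u b <= @marginal u i a].
rewrite (_ : best_actions^~ i = fun u => [set a | [ffun a => P a u] a]%SET); last first.
  by apply/funext => u; apply/setP => a; rewrite !inE ffunE.
apply: (measurable_discrete_select (fun f : {ffun action i -> bool} => [set a | f a]%SET)) => a.
have mm c : measurable_fun setT (fun u => @marginal u i c).
  rewrite /marginal; under eq_fun do rewrite -big_filter.
  by apply: measurable_sum => p; exact: measurable_total_payoff.
by apply: measurable_forall_fin => b; exact: measurable_ler_set.
Qed.

(* A single player maximizes the total payoff against uniform opponents: the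
   profile of largest total payoff is then met with probability at least the
   product of the opponents' uniform weights. *)
Definition leader_vec u : vec := fun i a =>
  if i == player0 then (a \in best_actions u i)%:R / #|best_actions u i|%:R
  else #|action i|%:R^-1.

Lemma leader_simplex u : is_simplex (leader_vec u).
Proof.
split=> i.
  by move=> a; rewrite /leader_vec; case: ifP => _; rewrite ?divr_ge0 ?invr_ge0 ?ler0n.
rewrite /leader_vec; case: (i == player0).
  rewrite -mulr_suml (eq_bigr (fun a => if a \in best_actions u i then 1 else 0)); last first.
    by move=> a _; case: (a \in _).
  by rewrite -big_mkcond /= sumr_const divff // pnatr_eq0 -lt0n best_actions_gt0.
by rewrite sumr_const -[LHS]mulr_natr mulVf // pnatr_eq0 -lt0n action_gt0.
Qed.

Lemma leader_vec_relabel u g i (a : action i) :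
  leader_vec (relabel_payoff u g) a = leader_vec u (g i a).
Proof.
by rewrite /leader_vec best_actions_relabel card_best_actions_relabel.
Qed.

Lemma measurable_leader_vec i (a : action i) : measurable_fun setT (fun u => leader_vec u a).
Proof.
rewrite /leader_vec; case: (i == player0); last exact: measurable_cst.
apply: (measurable_fun_discrete (h := best_actions^~ i) (G := fun A _ => ((a \in A)%:R / #|A|%:R : R))).
  exact: measurable_best_actions.
by move=> A; exact: measurable_cst.
Qed.

Lemma uniform_prod_ge : (M%:R ^+ (N - 1))^-1 <= \prod_(j : players s | j != player0) (#|action j|%:R^-1 : R).
Proof.
have M0 : (0 < M)%N.
  have := action_gt0 player0; rewrite card_ord => h; apply: (leq_trans h).
  by rewrite -ltnS ltn_ord.
apply: (@le_trans _ _ (\prod_(j : players s | j != player0) M%:R^-1)).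
  rewrite prodr_const exprVn lef_pV2 ?posrE ?exprn_gt0 ?ltr0n //.
  rewrite ler_weXn2l ?ler1n //.
  rewrite (_ : #|_| = #|predC1 player0|) // cardC1 card_ord -subn1 leq_sub2r //.
  by rewrite -ltnS ltn_ord.
apply: ler_prod => j _; rewrite invr_ge0 ler0n /= lef_pV2 ?posrE ?ltr0n ?action_gt0 //.
by rewrite ler_nat card_ord -ltnS ltn_ord.
Qed.

(** [c] is the weight of each profile of the opponents. An action in the leader's support earns [c]
    times the largest marginal, which is at least the marginal of [p player0], and the total payoff
    of [p] is one summand of the latter. *)
Lemma leader_welfare u p :
  total_payoff u p <= M%:R ^+ (N - 1) * value (total_payoff u) (leader_vec u).
Proof.
set c := \prod_(j : players s | j != player0) (#|action j|%:R^-1 : R).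
have c0 : 0 <= c by apply: prodr_ge0 => j _; rewrite invr_ge0 ler0n.
have t0 q : 0 <= total_payoff u q.
  apply: sumr_ge0 => i _; case: u => v /= /forallP/(_ i)/forallP/(_ q).
  by case/andP.
have dE (b : action player0) : dev_value (total_payoff u) b (leader_vec u) = c * marginal u b.
  rewrite mulr_sumr; apply: eq_bigr => q _; congr (_ * _).
  by apply: eq_bigr => j /negbTE jp; rewrite /leader_vec jp.
have : c * total_payoff u p <= value (total_payoff u) (leader_vec u).
  rewrite (valueE _ player0) -[leLHS]mul1r -((leader_simplex u).2 player0) mulr_suml.
  apply: ler_sum => b _; rewrite dE /leader_vec eqxx.
  case: (boolP (b \in _)) => [|_]; last by rewrite !mul0r.
  rewrite inE => /forallP/(_ (p player0)) h.
  apply: ler_wpM2l; first by rewrite mul1r invr_ge0 ler0n.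
  apply: ler_wpM2l => //; apply: le_trans h.
  by rewrite /marginal (bigD1 p) //= lerDl; exact: sumr_ge0.
move=> h.
have M0 : 0 < (M%:R ^+ (N - 1) : R).
  have := action_gt0 player0; rewrite card_ord => hM; apply: exprn_gt0.
  by rewrite ltr0n; apply: (leq_trans hM); rewrite -ltnS ltn_ord.
rewrite -ler_pdivrMl //; apply: le_trans h; apply: ler_wpM2r => //.
exact: uniform_prod_ge.
Qed.

End Shape.

Lemma max_approximator_exists : exists f : approximator R N M, NE_general f /\
  forall s (u : payoff R s) p, total_payoff u p <= social_welfare (f s u) u.
Proof.
exists (fun s u => pure (max_profile u)); split.
  move=> s i a.
  apply: (measurable_fun_discrete (h := @max_profile s) (G := fun p _ => pure p i a)).
    exact: measurable_max_profile.
  by move=> p; exact: measurable_cst.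
by move=> s u p; rewrite social_welfare_pure; exact: max_profileP.
Qed.

Lemma leader_approximator_exists : exists f : approximator R N M, NE_both f /\
  forall (f' : approximator R N M) s (u : payoff R s),
    social_welfare (f' s u) u <= M%:R ^+ (N - 1) * social_welfare (f s u) u.
Proof.
pose f : approximator R N M := fun s u => to_strategy (leader_simplex u).
exists f; split.
  apply: equivariant_both.
    move=> s i a; rewrite /f; under eq_fun do rewrite to_strategyE.
    exact: measurable_leader_vec.
  by move=> s u g i a; rewrite /f !to_strategyE leader_vec_relabel.
move=> f' s u; rewrite [leLHS]social_welfareE [X in _ * X]social_welfareE.
rewrite [X in _ * X](@value_ext _ _ _ _ _ _ (leader_vec u)); last first.
  by move=> i a; exact: to_strategyE.
apply: value_le; first exact: strategy_simplex.
by move=> p; exact: leader_welfare.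
Qed.

Lemma shape_exists n m : (2 <= n <= N)%N -> (0 < m <= M)%N ->
  exists s : shape N M, tag (shape_val s) = n :> nat /\ forall i : players s, #|action i| = m.
Proof.
move=> /andP[n2 nN] /andP[m0 mM].
have nN' : (n < N.+1)%N by []. have mM' : (m < M.+1)%N by [].
pose v : {n : 'I_N.+1 & {ffun 'I_n -> 'I_M.+1}} :=
  existT (fun n : 'I_N.+1 => {ffun 'I_n -> 'I_M.+1}) (Ordinal nN') [ffun=> Ordinal mM'].
have hv : (2 <= tag v)%N && [forall i, (1 <= tagged v i)%N].
  by rewrite n2; apply/forallP => i; rewrite ffunE.
by exists (Shape hv); split => // i; rewrite card_ord /= ffunE.
Qed.

End Approximators.

(** * Extremal games *)

Section Labels.
Variables (N M : nat) (s : shape N M) (m : nat).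
Hypothesis hs : forall i : players s, #|action i| = m.+1.
Implicit Types (i j : players s) (k : 'I_m.+1).

(** The action types of all players are identified with one cyclic group, so that labels of
    different players can be compared and shifted. *)
Definition lab i (a : action i) : 'I_m.+1 := cast_ord (hs i) (enum_rank a).
Definition unlab i k : action i := enum_val (cast_ord (esym (hs i)) k).

Lemma labK i : cancel (@lab i) (unlab i).
Proof. by move=> a; rewrite /lab /unlab cast_ordK enum_rankK. Qed.

Lemma unlabK i : cancel (unlab i) (@lab i).
Proof. by move=> k; rewrite /lab /unlab enum_valK cast_ordKV. Qed.

Lemma sum_unlab (V : nmodType) i (F : action i -> V) : \sum_a F a = \sum_k F (unlab i k).
Proof. by rewrite (reindex (unlab i)) //; exists (@lab i) => ? _; [exact: unlabK|exact: labK]. Qed.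

Lemma transport_perm_inj i (p : {perm 'I_m.+1}) : injective (fun a : action i => unlab i (p (lab a))).
Proof. by move=> a b /(can_inj (@unlabK i)) /perm_inj /(can_inj (@labK i)). Qed.

Definition transport_perm i (p : {perm 'I_m.+1}) : {perm action i} := perm (@transport_perm_inj i p).

Lemma lab_transport_perm i p (a : action i) : lab (transport_perm i p a) = p (lab a).
Proof. by rewrite permE unlabK. Qed.

End Labels.

(** * Shifted diagonal games *)

Section Diagonal.
Variables (R : realType) (N M : nat) (s : shape N M) (m : nat).
Hypothesis hs : forall i : players s, #|action i| = m.+1.
Local Notation vec := (forall i : players s, action i -> R).
Local Notation shifts := {ffun players s -> 'I_m.+1}.
Implicit Types (i j : players s) (k : 'I_m.+1) (c : shifts) (x : vec).
Local Notation lab := (lab hs).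
Local Notation unlab := (unlab hs).

Definition shift c : relabeling s :=
  finfun (fun i => transport_perm hs i (perm (addIr (c i)))).

Lemma lab_shift c i (a : action i) : lab (shift c i a) = lab a + c i.
Proof. by rewrite ffunE lab_transport_perm permE. Qed.

Lemma shift0 c i : c i = 0 -> shift c i = 1%g.
Proof.
move=> ci; apply/permP => a; rewrite perm1; apply: (can_inj (labK hs (i := i))).
by rewrite lab_shift ci addr0.
Qed.

(* The diagonal has [m.+1] profiles out of [m.+1 ^ n]; shifting the players'
   labels hides its position. *)
Definition diagonal_profile (a : profile s) : bool := [exists k, [forall i, lab (a i) == k]].

Lemma diagonal_subproof : [forall i, forall a, 0 <=
  ([ffun=> [ffun a => (diagonal_profile a)%:R]] : {ffun players s -> {ffun profile s -> R}}) i a <= 1].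
Proof. by apply/forallP => i; apply/forallP => a; rewrite !ffunE; case: (diagonal_profile _); rewrite ?lexx ?ler01. Qed.

Definition diagonal : payoff R s := Payoff diagonal_subproof.

Definition shifted c : payoff R s := relabel_payoff diagonal (shift c).

Lemma shiftedE c i a : shifted c i a = [exists k, [forall j, lab (a j) + c j == k]]%:R.
Proof.
rewrite relabel_payoffE /= !ffunE; congr (nat_of_bool _)%:R; apply/eq_existsb => k.
by apply/eq_forallb => j; rewrite ffunE lab_shift.
Qed.

Lemma shifted_translate c c' k : (forall i, c i = c' i + k) -> shifted c = shifted c'.
Proof.
move=> cc; apply: payoffP => i a; rewrite !shiftedE; congr (nat_of_bool _)%:R.
apply/existsP/existsP => -[l /forallP h]; [exists (l - k)|exists (l + k)]; apply/forallP => j.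
  by have := h j; rewrite cc addrA => /eqP <-; rewrite addrK.
by rewrite cc addrA; have /eqP -> := h j.
Qed.

(** At most one [k] fits a given profile, so the sum is the indicator of the shifted diagonal. As a
    sum of products it factorizes under mixed strategies. *)
Lemma total_shifted c a : total_payoff (shifted c) a =
  #|players s|%:R * \sum_k \prod_i (lab (a i) == k - c i)%:R.
Proof.
rewrite /total_payoff (eq_bigr _ (fun i _ => shiftedE c i a)) sumr_const -[LHS]mulr_natl.
congr (_ * _); case: existsP => [[k0 /forallP h]|hn].
  rewrite (bigD1 k0) //= big1 => [|i _]; last by rewrite -(eqP (h i)) addrK eqxx.
  rewrite big1 ?addr0 // => k kk0; rewrite (bigD1 (player0 s)) //=.
  rewrite (_ : (_ == _) = false) ?mul0r //.
  apply: contraNF kk0 => /eqP e; rewrite -(eqP (h (player0 s))) e subrK //.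
rewrite big1 // => k _.
have [j hj] : exists j, lab (a j) != k - c j.
  apply/existsP; apply: contra_notT hn => /existsPn h; exists k; apply/forallP => j.
  by have := h j; rewrite negbK => /eqP ->; rewrite subrK.
by rewrite (bigD1 j) //= (negbTE hj) mul0r.
Qed.

Lemma value_shifted c x : value (total_payoff (shifted c)) x =
  #|players s|%:R * \sum_k \prod_i x i (unlab i (k - c i)).
Proof.
rewrite /value (eq_bigr (fun a : profile s => #|players s|%:R *
   \sum_k \prod_i (x i (a i) * (lab (a i) == k - c i)%:R))); last first.
  move=> a _; rewrite total_shifted mulrCA; congr (_ * _).
  by rewrite mulr_sumr; apply: eq_bigr => k _; rewrite big_split.
rewrite -mulr_sumr exchange_big /=; congr (_ * _); apply: eq_bigr => k _.
rewrite -(prod_sum_dffun (fun i a => x i a * (lab a == k - c i)%:R)).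
apply: eq_bigr => i _; rewrite (bigD1 (unlab i (k - c i))) //= unlabK eqxx mulr1.
rewrite big1 ?addr0 // => a ha; rewrite (_ : (_ == _) = false) ?mulr0 //.
by apply: contraNF ha => /eqP <-; rewrite labK.
Qed.

(** For fixed [k] the sum over independent shifts factorizes into the players' total masses, so
    every [k] contributes 1. *)
Lemma sum_shifts x : is_simplex x ->
  \sum_(c : shifts) \sum_k \prod_i x i (unlab i (k - c i)) = m.+1%:R.
Proof.
move=> [_ x1]; rewrite exchange_big /= -[in RHS](card_ord m.+1) -sum1_card natr_sum.
apply: eq_bigr => k _.
rewrite -(bigA_distr_bigA (fun i l => x i (unlab i (k - l)))) /= big1 // => i _.
rewrite -(x1 i) (sum_unlab hs) [RHS](reindex_inj (subrI k)) //.
Qed.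

(** The hypothesis covers both classes: along the shifted diagonal a player's output is a fixed
    mixed action displaced by the player's own shift (OPI, [p] the identity) or by the opponent's
    (PPE, [p] the exchange). Permuting the coordinates of [c] by [p] reduces the average to
    [sum_shifts]. *)
Lemma SWR_diagonal_le (hN : (2 <= N)%N) (hM : (2 <= M)%N) (F : set (approximator R N M)) :
  F `<=` NE_general ->
  (forall f, F f -> exists (x : vec) (p : {perm players s}), is_simplex x /\
    forall c i k, f s (shifted c) i (unlab i (k - c i)) = x i (unlab i (k - c (p i)))) ->
  (SWR hN hM F NE_general <= (m.+1%:R / m.+1%:R ^+ #|players s|)%:E)%E.
Proof.
move=> Fgen hF; set n := #|players s|.
have n0 : (0 < n%:R :> R) by rewrite ltr0n /n card_ord players_gt0.
pose g c : game R hN hM := existT (fun s => payoff R s) s (shifted c).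
have [D hD] := uniform_probability R ([ffun=> 0] : shifts) g.
have cardC : #|{: shifts}|%:R = m.+1%:R ^+ n :> R by rewrite card_ffun card_ord natrX.
have C0 : 0 < m.+1%:R ^+ n :> R by rewrite exprn_gt0 ?ltr0n.
have ED f : NE_general f -> expected_welfare D f =
    ((m.+1%:R ^+ n)^-1 * \sum_(c : shifts) social_welfare (f s (shifted c)) (shifted c))%:E.
  move=> mf; rewrite -cardC; apply: (hD (welfare f)).
    exact: measurable_welfare.
  exact: welfare_ge0.
rewrite (_ : m.+1%:R / _ = ((m.+1%:R ^+ n)^-1 * (n%:R * m.+1%:R)) / n%:R :> R); last first.
  by rewrite (mulrC n%:R) mulrA mulfK ?gt_eqF // mulrC.
apply: (@SWR_le _ _ _ _ _ _ _ D) => //.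
- apply: ge_ereal_sup => _ [f Ff <-]; rewrite ED; last exact: Fgen.
  rewrite lee_fin; apply: ler_wpM2l; first by rewrite invr_ge0 ltW.
  have [x [p [hx fx]]] := hF f Ff.
  rewrite -(sum_shifts hx) mulr_sumr.
  rewrite [leRHS](reindex (fun c => [ffun i => c (p i)])) /=; last first.
    exists (fun c => [ffun i => c (p^-1 i)%g]) => c _; apply/ffunP => i; rewrite !ffunE.
      by rewrite permKV.
    by rewrite permK.
  apply: ler_sum => c _; rewrite social_welfareE value_shifted le_eqVlt; apply/orP; left; apply/eqP.
  congr (_ * _); apply: eq_bigr => k _; apply: eq_bigr => i _.
  by rewrite fx ffunE.
have [f [gf hf]] := max_approximator_exists R N M.
apply: le_trans (best_welfare_ge D gf); rewrite ED // lee_fin.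
rewrite ler_pdivlMl // -cardC mulr_natl -sumr_const; apply: ler_sum => c _.
(* This profile lies on the shifted diagonal with [k = 0], so everybody is paid. *)
pose a : profile s := finfun (fun i => unlab i (- c i)).
apply: le_trans (hf s (shifted c) a); rewrite total_shifted ler_peMr ?ler0n //.
rewrite (bigD1 0) //= big1 => [|i _]; last by rewrite ffunE unlabK sub0r eqxx.
by rewrite lerDl; apply: sumr_ge0 => k _; apply: prodr_ge0 => i _; rewrite ler0n.
Qed.

(* Only the differences of the shifts matter, so one can assume that player [i]
   is not shifted at all. *)
Lemma OPI_shifted f c i : is_OPI f -> f s (shifted c) i = f s diagonal i.
Proof.
move=> hf; pose c' : shifts := [ffun j => c j - c i].
rewrite (@shifted_translate c c' (c i)); last by move=> j; rewrite ffunE subrK.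
by apply: OPI_relabel => //; apply: shift0; rewrite ffunE subrr.
Qed.

(** After a translation that leaves the only opponent [j] unshifted, what remains is player [i]'s
    own relabelling by [c i - c j], which PPE carries over to the output. *)
Lemma PPE_shifted f c i j k : is_PPE f -> (forall l, (l != i) = (l == j)) ->
  f s (shifted c) i (unlab i (k - c i)) = f s diagonal i (unlab i (k - c j)).
Proof.
move=> hf hj; pose c' : shifts := [ffun l => c l - c j].
rewrite (@shifted_translate c c' (c j)); last by move=> l; rewrite ffunE subrK.
have -> : shifted c' = relabel_payoff diagonal (relabeling_single (shift c' i)).
  congr (relabel_payoff _ _); apply/ffunP => l.
  have [->|il] := eqVneq i l; first by rewrite relabeling_single_same.
  have /eqP -> : l == j by rewrite -hj eq_sym.
  rewrite relabeling_single_other; first by apply: shift0; rewrite ffunE subrr.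
  by rewrite eq_sym hj.
rewrite PPE_relabel //; congr (f s diagonal i _).
apply: (can_inj (labK hs (i := i))); rewrite lab_shift !unlabK ffunE.
by rewrite addrA subrK.
Qed.

End Diagonal.

(** * Good and poor equilibria for the oracle ratio *)

Section PureNash.
Variables (R : realType) (N M : nat).

Definition pure_nash (s : shape N M) (u : payoff R s) (p : profile s) : bool :=
  [forall i, forall b : action i,
    dev_value (u i) b (fun j => pure R p j) <= value (u i) (fun j => pure R p j)].

Lemma pure_nashP (s : shape N M) (u : payoff R s) p : pure_nash u p -> is_nash u (pure R p).
Proof. by move=> /forallP h; apply: nashP => i b; have /forallP := h i; exact. Qed.

(** Serves to bound the denominator from below. An existing oracle is patched by a pure equilibrium
    of welfare at least [c] wherever there is one; with finitely many profiles the patch stays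
    measurable. *)
Lemma oracle_with_welfare (c : R) : exists f : approximator R N M, oracle_general f /\
  forall s (u : payoff R s) p, pure_nash u p -> c <= total_payoff u p ->
    c <= social_welfare (f s u) u.
Proof.
have [f0 [[mf0 nf0] _]] := oracle_both_exists R N M.
pose P s p (u : payoff R s) := pure_nash u p && (c <= total_payoff u p).
pose f : approximator R N M := fun s u =>
  if [pick p | [ffun p => P s p u] p] is Some p then pure R p else f0 s u.
exists f; split; last first.
  move=> s u p np cp; rewrite /f; case: pickP => [q|/(_ p)]; rewrite ffunE /P.
    by case/andP => _ cq; rewrite social_welfare_pure.
  by rewrite np cp.
split; last first.
  move=> s u; rewrite /f; case: pickP => [q|_]; last exact: nf0.
  by rewrite ffunE => /andP[nq _]; exact: pure_nashP.
move=> s i a.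
rewrite (_ : (fun u => _) = fun u => (fun (o : option (profile s)) (u : payoff R s) =>
    if o is Some p then pure R p i a else f0 s u i a) [pick p | [ffun p => P s p u] p] u); last first.
  by apply/funext => u; rewrite /f; case: pickP.
apply: (measurable_fun_discrete (h := fun u => [pick p | [ffun p => P s p u] p])
  (G := fun o u => if o is Some p then pure R p i a else f0 s u i a)); last first.
  by case=> [p|]; [exact: measurable_cst|exact: mf0].
apply: (measurable_discrete_select (fun f : {ffun profile s -> bool} => [pick p | f p])) => p.
apply: measurable_andb; last first.
  by apply: measurable_ler_set; [exact: measurable_cst|exact: measurable_total_payoff].
apply: measurable_forall_fin => j; apply: measurable_forall_fin => b.
by apply: measurable_ler_set; [exact: measurable_dev_value|exact: measurable_value].
Qed.

End PureNash.

Section TwoPlayers.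
Variables (N M : nat) (s : shape N M).
Hypothesis h2 : tag (shape_val s) = 2%N :> nat.
Implicit Types i l : players s.

(** Reversing the numbering exchanges the players when there are two. *)
Definition opponent i : players s := rev_ord (i : 'I_(tag (shape_val s))).

Lemma opponent_inj : injective opponent.
Proof. exact: rev_ord_inj. Qed.

Lemma opponentP i l : (l != i) = (l == opponent i).
Proof.
rewrite -!(inj_eq val_inj) /=.
have := ltn_ord (i : 'I_(tag (shape_val s))); have := ltn_ord (l : 'I_(tag (shape_val s))).
by move: h2; lia.
Qed.

Lemma opponent_neq i : i != opponent i.
Proof. by rewrite eq_sym opponentP eqxx. Qed.

Lemma dev_value_opponent (R : realType) (w : profile s -> R) i (b : action i) h x :
  (forall p : profile s, p i = b -> w p = h (p (opponent i))) ->
  dev_value w b x = \sum_c x (opponent i) c * h c.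
Proof.
(* Both entries of the default profile are overwritten, so [mk] parametrizes the profiles with
   [p i = b] by the opponent's action. *)
move=> wh; pose mk c : profile s := finfun (dfwith (dfwith (profile0 s) i b) (opponent i) c).
have mki c : mk c i = b.
  by rewrite ffunE dfwithout 1?eq_sym ?opponent_neq // dfwithin.
have mko c : mk c (opponent i) = c by rewrite ffunE dfwithin.
rewrite /dev_value (reindex_onto mk (fun p => p (opponent i))); last first.
  move=> p /eqP pi; apply/ffunP => j; rewrite ffunE.
  have [E|oj] := eqVneq (opponent i) j; first by subst j; rewrite dfwithin.
  rewrite dfwithout //.
  have E : i = j by apply/eqP; apply: contraNT oj => ij; rewrite eq_sym -opponentP eq_sym.
  by subst j; rewrite dfwithin.
apply: eq_big => c; first by rewrite mki mko !eqxx.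
move=> _; rewrite wh // mko; congr (_ * _).
rewrite (big_pred1 (opponent i)) ?mko // => j; exact: opponentP.
Qed.

End TwoPlayers.

Section ThreeActions.
Variables (R : realType) (N M : nat) (s : shape N M).
Hypotheses (h2 : tag (shape_val s) = 2%N :> nat) (hs : forall i : players s, #|action i| = 3).
Variable (d : R).
Hypotheses (d_gt0 : 0 < d) (d_le1 : d <= 1).
Implicit Types i : players s.
Local Notation lab := (lab hs).
Local Notation unlab := (unlab hs).

Definition act0 : 'I_3 := @Ordinal 3 0 isT.
Definition act1 : 'I_3 := @Ordinal 3 1 isT.
Definition act2 : 'I_3 := @Ordinal 3 2 isT.

Lemma sum_act (F : 'I_3 -> R) : \sum_k F k = F act0 + F act1 + F act2.
Proof.
rewrite !big_ord_recl big_ord0 addr0 addrA.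
by congr (_ + _ + _); congr F; exact: val_inj.
Qed.

(* Actions [act0] and [act1] are interchangeable coordination actions. A player
   facing their uniform mixture prefers the safe action [act2], so the only
   equilibrium invariant under the interchange is the poor one. *)
Definition safe_coordination (a b : 'I_3) : R :=
  if a == act2 then (if b == act2 then d else 3 / 4) else (a == b)%:R.

Lemma safe_coordination01 a b : 0 <= safe_coordination a b <= 1.
Proof.
rewrite /safe_coordination; case: (a == act2); last first.
  by case: (a == b); rewrite ?lexx ?ler01.
by case: (b == act2); apply/andP; split; move: d_gt0 d_le1; lra.
Qed.

Lemma coordination_subproof : [forall i, forall a, 0 <=
  ([ffun i : players s => [ffun a : profile s => safe_coordination (lab (a i)) (lab (a (opponent i)))]]
    : {ffun players s -> {ffun profile s -> R}}) i a <= 1].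
Proof. by apply/forallP => i; apply/forallP => a; rewrite !ffunE safe_coordination01. Qed.

Definition coordination : payoff R s := Payoff coordination_subproof.

Lemma coordinationE i a : coordination i a = safe_coordination (lab (a i)) (lab (a (opponent i))).
Proof. by rewrite /= !ffunE. Qed.

Lemma dev_coordination i (b : action i) x : dev_value (coordination i) b x =
  \sum_k x (opponent i) (unlab (opponent i) k) * safe_coordination (lab b) k.
Proof.
rewrite (dev_value_opponent h2 (h := fun c => safe_coordination (lab b) (lab c))).
  by rewrite (sum_unlab hs); apply: eq_bigr => k _; rewrite unlabK.
by move=> p <-; rewrite coordinationE.
Qed.

Definition interchange : relabeling s := finfun (fun i => transport_perm hs i (tperm act0 act1)).

Lemma coordination_interchange : relabel_payoff coordination interchange = coordination.
Proof.
apply: payoffP => i a; rewrite relabel_payoffE !coordinationE !ffunE !lab_transport_perm.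
rewrite /safe_coordination (inj_eq perm_inj).
have t2 k : (tperm act0 act1 k == act2) = (k == act2).
  by rewrite -[in LHS](tpermD (x := act0) (y := act1) (z := act2)) // (inj_eq perm_inj).
by rewrite !t2.
Qed.

(** By interchange both coordination actions have the same weight [t i], and the safe one has
    [r i = 1 - 2 t i]. Deviating to safe play would gain [2 t i (t/2 + r d)], with [t] and [r] those
    of the opponent. As [d > 0], the bracket is positive, so equilibrium forces [t i = 0]. *)
Lemma symmetric_coordination_welfare (f : approximator R N M) : oracle_both f ->
  social_welfare (f s coordination) coordination = 2 * d.
Proof.
move=> [[_ nf] [[_ fO] [_ fP]]].
pose x := fun i => f s coordination i : action i -> R.
have [x0 x1] : is_simplex x by exact: strategy_simplex.
pose t i := x i (unlab i act0); pose r i := x i (unlab i act2).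
have x01 i : x i (unlab i act1) = t i.
  have := both_relabel coordination interchange (unlab i act0) fO fP.
  rewrite coordination_interchange /t /x => ->; congr (f s coordination i _).
  by rewrite ffunE permE unlabK tpermL.
have tr i : 2 * t i + r i = 1.
  have := x1 i; rewrite (sum_unlab hs) sum_act x01 -/(t i) -/(r i); lra.
have dev k i : dev_value (coordination i) (unlab i k) x =
    t (opponent i) * safe_coordination k act0 + t (opponent i) * safe_coordination k act1 +
    r (opponent i) * safe_coordination k act2.
  by rewrite dev_coordination sum_act unlabK x01.
have val i : utility coordination i (f s coordination) =
    2 * t i * t (opponent i) + r i * (3 / 2 * t (opponent i) + r (opponent i) * d).
  rewrite utilityE -/x (valueE _ i) (sum_unlab hs) sum_act !dev x01 -/(t i) -/(r i).
  by rewrite /safe_coordination /=; field.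
have t_eq0 i : t i = 0.
  have := nash_dev (unlab i act2) (nf s coordination).
  rewrite val -/x dev /safe_coordination /=.
  set to := t (opponent i); set ro := r (opponent i).
  have t0 : 0 <= t i by exact: x0.
  have to0 : 0 <= to by exact: x0.
  have ro0 : 0 <= ro by exact: x0.
  have rt : 2 * to + ro = 1 by exact: tr.
  have -> : r i = 1 - 2 * t i by have := tr i; lra.
  move: rt to0 ro0.
  move: (t i) to ro t0 => ti {x01 tr dev val} to ro t0 rt to0 ro0.
  have e0 : 0 < to / 2 + ro * d.
    have [toE|tn0] := eqVneq to 0; last first.
      have tp : 0 < to by rewrite lt_def tn0.
      by apply: ltr_pwDl; [rewrite divr_gt0|exact: mulr_ge0 ro0 (ltW d_gt0)].
    by rewrite toE mul0r add0r mulr_gt0 //; lra.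
  move=> h; apply/eqP; rewrite eq_le t0 andbT leNgt; apply/negP => tp.
  have gap : 2 * ti * to + (1 - 2 * ti) * (3 / 2 * to + ro * d) =
      to * (3 / 4) + to * (3 / 4) + ro * d - 2 * (ti * (to / 2 + ro * d)) by field.
  move: h (mulr_gt0 tp e0); rewrite gap; lra.
rewrite /social_welfare (eq_bigr (fun=> d)) => [|i _].
  by rewrite sumr_const -[LHS]mulr_natl card_ord h2.
have r1 j : r j = 1 by have := tr j; rewrite t_eq0; lra.
by rewrite val !t_eq0 !r1 !mulr0 !add0r !mul1r.
Qed.

Definition coordinated : profile s := finfun (fun i => unlab i act0).

Lemma coordinated_payoff i : coordination i coordinated = 1.
Proof. by rewrite coordinationE !ffunE !unlabK. Qed.

(** Everybody already gets 1, the largest possible payoff. *)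
Lemma coordinated_nash : pure_nash coordination coordinated.
Proof.
apply/forallP => i; apply/forallP => b.
rewrite value_pure coordinated_payoff dev_coordination.
have [y0 y1] := strategy_simplex (pure R coordinated).
rewrite -[leRHS](y1 (opponent i)) (sum_unlab hs); apply: ler_sum => k _.
by rewrite ler_piMr //; case/andP: (safe_coordination01 (lab b) k).
Qed.

Lemma coordinated_welfare : total_payoff coordination coordinated = 2.
Proof.
rewrite /total_payoff (eq_bigr (fun=> 1)) => [|i _]; last exact: coordinated_payoff.
by rewrite sumr_const -[LHS]mulr_natl card_ord h2 mulr1.
Qed.

Lemma SWR_oracle_le (hN : (2 <= N)%N) (hM : (2 <= M)%N) :
  (SWR hN hM (@oracle_both R N M) oracle_general <= d%:E)%E.
Proof.
pose g (_ : unit) : game R hN hM := existT (fun s => payoff R s) s coordination.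
have [D hD] := uniform_probability R tt g.
have ED f : NE_general f -> expected_welfare D f = (social_welfare (f s coordination) coordination)%:E.
  move=> mf; transitivity ((#|{: unit}|%:R^-1 * \sum_c welfare f (g c))%:E).
    by apply: (hD (welfare f)); [exact: measurable_welfare|exact: welfare_ge0].
  by rewrite card_unit invr1 mul1r (big_pred1 tt) //; case.
rewrite (_ : d = 2 * d / 2); last by field.
apply: (@SWR_le _ _ _ _ _ _ _ D) => //.
- by rewrite mulr_ge0 // ltW.
- apply: ge_ereal_sup => _ [f Ff <-]; rewrite ED; last by case: Ff => -[].
  by rewrite symmetric_coordination_welfare.
have [f [gf hf]] := oracle_with_welfare N M (2 : R).
apply: le_trans (best_welfare_ge D gf); rewrite ED ?lee_fin; last by case: gf.
by apply: (hf _ _ _ coordinated_nash); rewrite coordinated_welfare.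
Qed.

End ThreeActions.

(** * The four ratios *)

Local Open Scope ereal_scope.

Theorem theorem5p7 (R : realType) (N M : nat)
    (hN : (2 <= N)%N) (hM : (2 <= M)%N) :
  [/\ SWR hN hM (@NE_OPI R N M) NE_general = ((M%:R ^+ (N - 1))^-1)%R%:E,
      SWR hN hM (@NE_PPE R N M) NE_general <= ((M%:R)^-1)%R%:E
    & SWR hN hM (@NE_both R N M) NE_general = ((M%:R ^+ (N - 1))^-1)%R%:E] /\
  ((3 <= M)%N -> SWR hN hM (@oracle_both R N M) oracle_general = 0).
Proof.
have M0 : (0 < M)%N by exact: ltnW.
have MR : (M%:R != 0 :> R)%R by rewrite pnatr_eq0 -lt0n.
have cE n : (2 <= n)%N -> (M%:R / M%:R ^+ n = (M%:R ^+ (n - 1))^-1 :> R)%R.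
  move=> n2; rewrite -[in LHS](subnK (ltnW n2)) addn1 exprSr invfM mulrCA divff ?mulr1 //.
have upper : SWR hN hM (@NE_OPI R N M) NE_general <= ((M%:R ^+ (N - 1))^-1)%R%:E.
  have [|//|s [sN hs]] := @shape_exists N M N M; first by rewrite hN leqnn.
    by rewrite M0 leqnn.
  have hs' i : #|@action N M s i| = M.-1.+1 by rewrite prednK.
  have <- : (M.-1.+1%:R / M.-1.+1%:R ^+ #|players s| = (M%:R ^+ (N - 1))^-1 :> R)%R.
    by rewrite prednK // card_ord sN cE.
  apply: (SWR_diagonal_le (hs := hs')); first by move=> f [].
  move=> f [_ hf]; exists (fun i => f s (diagonal R hs') i), 1%g; split.
    exact: strategy_simplex.
  by move=> c i k; rewrite perm1 OPI_shifted.
have lower : ((M%:R ^+ (N - 1))^-1)%R%:E <= SWR hN hM (@NE_both R N M) NE_general.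
  apply: le_SWR => //; first by rewrite exprn_gt0 // ltr0n.
  have [f [bf hf]] := leader_approximator_exists R N M.
  have mf : NE_general f by case: bf => -[].
  move=> D; apply: ge_ereal_sup => _ [f' mf' <-].
  apply: (@le_trans _ _ ((M%:R ^+ (N - 1))%R%:E * expected_welfare D f)).
    by apply: expected_welfare_le => // g; exact: hf.
  by apply: lee_wpmul2l; [rewrite lee_fin exprn_ge0|exact: best_welfare_ge].
have both_le : SWR hN hM (@NE_both R N M) NE_general <= SWR hN hM NE_OPI NE_general.
  by apply: SWR_subset => f [].
split; first split.
- by apply/le_anti; rewrite upper (le_trans lower).
(* Two players with [M] actions each give [M / M^2], and the permutation is their exchange. *)
- have [//||s [s2 hs]] := @shape_exists N M 2 M; first by rewrite M0 leqnn.
  have hs' i : #|@action N M s i| = M.-1.+1 by rewrite prednK.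
  have <- : (M.-1.+1%:R / M.-1.+1%:R ^+ #|players s| = M%:R^-1 :> R)%R.
    by rewrite prednK // card_ord s2 cE // expr1.
  apply: (SWR_diagonal_le (hs := hs')); first by move=> f [].
  move=> f [_ hf]; exists (fun i => f s (diagonal R hs') i), (perm (@opponent_inj N M s)); split.
    exact: strategy_simplex.
  by move=> c i k; rewrite permE; apply: PPE_shifted => // l; exact: opponentP.
- by apply/le_anti; rewrite lower (le_trans both_le).
move=> M3; have [//||s [s2 hs]] := @shape_exists N M 2 3; first by rewrite M3.
have [f bf] := oracle_both_exists R N M.
have le_d (d : R) : (0 < d)%R -> (d <= 1)%R -> SWR hN hM (@oracle_both R N M) oracle_general <= d%:E.
  by move=> d0 d1; exact: (SWR_oracle_le s2 hs d0 d1).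
apply/le_anti; rewrite (SWR_ge0 hN hM oracle_general bf) andbT.
apply/lee_addgt0Pr => e e0; rewrite add0e.
(* [Num.min e 1] keeps the payoff [d] of the game at most 1. *)
apply: (@le_trans _ _ (Num.min e 1)%:E); last by rewrite lee_fin ge_min lexx.
by apply: le_d; rewrite ?lt_min ?e0 ?ltr01 // ge_min lexx orbT.
Qed.
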